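(* Let $V$ be a complex vector space of finite dimension $n\ge 1$, let $\mathcal H=\{\zeta\in\mathbb C;\ \mathrm{Re}\,\zeta>0\}$, and let $\|\cdot\|_t$ be a (singular) metric of negative curvature and moderate growth on the trivial bundle $E=V\times\mathcal H$ over $\mathcal H$, depending only on $t=\mathrm{Re}\,\zeta$ and extending continuously to $t=0$. Let $\|\cdot\|_{-t}$ be the dual metric on $E^*=V^*\times\mathcal H$. Let $\alpha_1\le\dots\le\alpha_n$ be the jumping numbers of the metric, $\alpha_0=-\infty$, and let $V_\alpha\subseteq V$ and $F_\alpha=V_\alpha^\perp\subseteq V^*$ be the associated filtrations. Let $j\in\{0,\dots,n-1\}$ and let $\alpha\in\mathbb R$ satisfy $\alpha_j\le\alpha<\alpha_{j+1}$. Then the following are equivalent for $v\in V^*$: (a) $v\in F_{\alpha_j}$; (b) $\displaystyle\int_0^\infty\|v\|^2_{-t}\,e^{t\alpha}\,dt<\infty$; (c) $\displaystyle\limsup_{t\to\infty}\frac1t\log\|v\|^2_{-t}\le-\alpha_{j+1}$.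
   Context: A metric on $E=V\times\mathcal H$ depending only on $t=\mathrm{Re}\,\zeta$ is a family $\|\cdot\|_t$, $t>0$, of norms on $V$, each given by a positive definite Hermitian form, where $\|\cdot\|_t$ is the norm on the fiber over $\zeta$ when $\mathrm{Re}\,\zeta=t$. Negative curvature: for every holomorphic map $\zeta\mapsto u(\zeta)\in V$ on an open subset of $\mathcal H$, the function $\zeta\mapsto\|u(\zeta)\|^2_{\mathrm{Re}\,\zeta}$ is subharmonic. (Equivalently, $\log\|u(\zeta)\|_{\mathrm{Re}\,\zeta}$ is subharmonic for all such $u$; in particular $t\mapsto\log\|u\|_t$ is convex and continuous on $(0,\infty)$ for each fixed $u\in V\setminus\{0\}$.) Extending continuously to $t=0$: for each $u\in V\setminus\{0\}$ the function $\log\|u\|_t$ extends continuously (with a finite value) to $t=0$; this defines the norm $\|\cdot\|_0$. Moderate growth: there is a constant $a\in\mathbb R$ and, for each $u\in V$, a constant $C(u)$ such that $\|u\|_t^2\le C(u)e^{at}$ for all $t$. Dual metric: for $v\in V^*$ and $t\geq 0$, $\|v\|_{-t}=\sup\{|v(u)|;\ u\in V,\ \|u\|_t\le 1\}$. Filtrations: for $u\in V\setminus\{0\}$ put $\alpha(u)=\lim_{t\to\infty}\frac1t\log\|u\|_t^2$ (the limit exists by convexity), and $\alpha(0)=-\infty$. For $\alpha\in\mathbb R$, $V_\alpha=\{u\in V;\ \alpha(u)\le\alpha\}$, which is a linear subspace. The jumping numbers $\alpha_1\le\dots\le\alpha_n$ are the real numbers $\alpha_j=\min\{\alpha;\ \dim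 V_\alpha\ge j\}$; thus if $\alpha_j\le\alpha<\alpha_{j+1}$ then $V_\alpha=V_{\alpha_j}$ has dimension $j$, and $V_{\alpha_n}=V$. Put $\alpha_0=-\infty$ and $V_{\alpha_0}=\{0\}$. Finally $F_\alpha=V_\alpha^\perp=\{v\in V^*;\ v(u)=0\text{ for all }u\in V_\alpha\}$, so $F_{\alpha_0}=V^*$ and $F_{\alpha_n}=\{0\}$. Convention: $\log 0=-\infty$. *)

(* Defs.v *)
From HB Require Import structures.
From mathcomp Require Import all_boot all_order all_algebra.
From mathcomp Require Import complex.
From mathcomp Require Import all_classical all_reals all_analysis.

Set Implicit Arguments.
Unset Strict Implicit.
Unset Printing Implicit Defensive.

Import Order.TTheory GRing.Theory Num.Theory.
Import numFieldNormedType.Exports.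

Local Open Scope classical_set_scope.
Local Open Scope ring_scope.

(* MathComp-Analysis puts the topology of C on R[i] seen as a numFieldType. *)
Notation Cplx R := (complex_complex__canonical__Num_NumField R).

Definition right_half_plane (R : realType) : set (Cplx R) :=
  [set z | 0 < complex.Re z].

(* Upper semicontinuity and the sub-mean value inequality over every closed
   disk contained in the open set U; only the values of f on U matter. *)
Definition subharmonic (R : realType) (U : set (Cplx R))
    (f : Cplx R -> \bar R) : Prop :=
  [/\ forall z, U z -> (f z < +oo)%E,
      forall z, U z -> forall a : R, (f z < a%:E)%E ->
        \forall w \near z, (f w < a%:E)%E &
      forall (z : Cplx R) (r : R), 0 < r ->
        [set w : Cplx R | ComplexField.Normc.normc (w - z) <= r] `<=` U ->
        (f z <= ((2 * pi)^-1)%:E *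
          \int[lebesgue_measure]_(x in `[0%R, (2 * pi)%R])
             f (z + r%:C%C * (cos x +i* sin x)%C)%R)%E].

(* V carries no topology; a V-valued map is holomorphic when its coordinates
   are, a condition that does not depend on the basis. *)
Definition holomorphic (R : realType) (V : vectType R[i]) (U : set (Cplx R))
    (u : Cplx R -> V) : Prop :=
  forall (i : 'I_(\dim {:V})) (z : Cplx R), U z ->
    derivable (fun w : (Cplx R)^o =>
      coord (vbasis {:V}) i (u w) : (Cplx R)^o) z 1.

(* A metric is given by the forms H t for t > 0; the values of H at t <= 0 are
   never used. *)
Definition form_norm (R : realType) (V : vectType R[i])
    (H : R -> {dot V for Num.conj}) (t : R) (u : V) : R :=
  Num.sqrt (complex.Re (H t u u)).

Definition extends_to_zero (R : realType) (V : vectType R[i])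
    (H : R -> {dot V for Num.conj}) : Prop :=
  forall u : V, u != 0 -> cvg (ln (form_norm H t u) @[t --> 0^'+]).

Definition metric_norm (R : realType) (V : vectType R[i])
    (H : R -> {dot V for Num.conj}) (t : R) (u : V) : R :=
  if 0 < t then form_norm H t u
  else if u == 0 then 0
  else expR (lim (ln (form_norm H s u) @[s --> 0^'+])).

Definition negative_curvature (R : realType) (V : vectType R[i])
    (H : R -> {dot V for Num.conj}) : Prop :=
  forall (U : set (Cplx R)) (u : Cplx R -> V),
    open U -> U `<=` @right_half_plane R -> holomorphic U u ->
    subharmonic U (fun z => (metric_norm H (complex.Re z) (u z) ^+ 2)%:E).

Definition moderate_growth (R : realType) (V : vectType R[i])
    (H : R -> {dot V for Num.conj}) : Prop :=
  exists a : R, forall u : V, exists C : R, forall t : R, 0 < t ->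
    metric_norm H t u ^+ 2 <= C * expR (a * t).

(* The norm written ||v||_{-t} in the literature, for t >= 0. *)
Definition dual_norm (R : realType) (V : vectType R[i])
    (H : R -> {dot V for Num.conj}) (t : R) (v : 'Hom(V, (R[i])^o)) : \bar R :=
  ereal_sup [set (ComplexField.Normc.normc (v u))%:E
            | u in [set u : V | metric_norm H t u <= 1]].

Definition growth_rate (R : realType) (V : vectType R[i])
    (H : R -> {dot V for Num.conj}) (u : V) : \bar R :=
  if u == 0 then -oo%E
  else lim ((t^-1 * ln (metric_norm H t u ^+ 2))%:E @[t --> +oo%R]).

Definition filtration (R : realType) (V : vectType R[i])
    (H : R -> {dot V for Num.conj}) (a : \bar R) : set V :=
  if a == -oo%E then [set 0] else [set u | (growth_rate H u <= a)%E].

(* The subspace with underlying set [filtration H a] (which is a linear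
   subspace for the metrics considered). *)
Definition filtration_space (R : realType) (V : vectType R[i])
    (H : R -> {dot V for Num.conj}) (a : \bar R) : {vspace V} :=
  xget 0%VS [set W : {vspace V} | [set u | u \in W] = filtration H a].

(* min {a in R | dim V_a >= j} for j >= 1. *)
Definition jumping_number (R : realType) (V : vectType R[i])
    (H : R -> {dot V for Num.conj}) (j : nat) : \bar R :=
  if j is 0%N then -oo%E
  else let S := [set a : R | (j <= \dim (filtration_space H a%:E))%N] in
       (xget 0 [set a | S a /\ lbound S a])%:E.

Definition annihilator (R : realType) (V : vectType R[i])
    (H : R -> {dot V for Num.conj}) (a : \bar R) : set 'Hom(V, (R[i])^o) :=
  [set v | forall u, filtration H a u -> v u = 0].

(* Main.v *)
(** Applied to the sections e^{cz} u, negative curvature makes t |-> log ||u||_t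
    convex for every fixed vector u, and nothing else is used of it.

    The heart is (a) => (c).  If it fails, there are beta < alpha_{j+1}, times
    T -> oo and vectors u_T with v(u_T) = 1 and ||u_T||_T^2 <= e^{beta T}.  The
    u_T need not be bounded, but u_T / |u_T| converges along an ultrafilter to
    some w != 0.  Convexity gives ||w||_t^2 <= C e^{dt} for every t as soon as
    ||u_T||_T^2 <= e^{dT} |u_T|^2 along the ultrafilter; taking the least such d
    shows that ||w||_T^2 exceeds ||u_T||_T^2 / |u_T|^2 by at most a factor
    e^{eps T}, and that w grows slower than e^{alpha_{j+1} t}, so v(w) = 0.
    Hence subtracting from u_T the multiple of w that kills a chosen coordinate
    changes neither v(u_T) nor, up to a factor e^{eps T}, the bound on the norm.
    After dim V such steps u_T = 0, contradicting v(u_T) = 1.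

    The rest is soft: by (a) the squared dual norm is at most e^{-beta t} for
    large t and each beta < alpha_{j+1}, which gives (b) and (c), and if
    v(u) != 0 for some u in V_{alpha_j} then |v(u)| / ||u||_t bounds the dual
    norm from below, so that (b) and (c) fail. *)
Require Import Defs.
From HB Require Import structures.
From mathcomp Require Import all_boot all_order all_algebra.
From mathcomp Require Import complex.
From mathcomp Require Import all_classical all_reals all_analysis.
From mathcomp Require Import ring lra.
Set Implicit Arguments.
Unset Strict Implicit.
Unset Printing Implicit Defensive.
Import Order.TTheory GRing.Theory Num.Theory.
Import numFieldNormedType.Exports.
Local Open Scope classical_set_scope.
Local Open Scope ring_scope.

(** * Squared moduli and squared norms on V *)

Definition sqabs (R : realType) (z : R[i]) : R :=
  complex.Re z ^+ 2 + complex.Im z ^+ 2.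

Section SquaredModulus.
Variable R : realType.
Implicit Types z w : R[i].

Lemma normc_sqabs z : ComplexField.Normc.normc z ^+ 2 = sqabs z.
Proof. by case: z => x y; rewrite sqr_sqrtr// addr_ge0 ?sqr_ge0. Qed.

Lemma sqabs_ge0 z : 0 <= sqabs z.
Proof. by rewrite addr_ge0 ?sqr_ge0. Qed.

Lemma sqabsM z w : sqabs (z * w) = sqabs z * sqabs w.
Proof. by rewrite -!normc_sqabs ComplexField.Normc.normcM exprMn. Qed.

Lemma sqabs0 : sqabs (0 : R[i]) = 0.
Proof. by rewrite /sqabs /= expr0n /= addr0. Qed.

Lemma sqabs1 : sqabs (1 : R[i]) = 1.
Proof. by rewrite /sqabs /= expr0n expr1n addr0. Qed.

Lemma sqabs_gt0 z : (0 < sqabs z) = (z != 0).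
Proof.
rewrite lt_def sqabs_ge0 andbT -normc_sqabs sqrf_eq0; congr (~~ _).
apply/eqP/eqP => [/ComplexField.Normc.eq0_normc//|->].
by rewrite ComplexField.Normc.normc0.
Qed.

Lemma sqabsV z : sqabs z^-1 = (sqabs z)^-1.
Proof. by rewrite -!normc_sqabs ComplexField.Normc.normcV exprVn. Qed.

Lemma sqabsN z : sqabs (- z) = sqabs z.
Proof. by rewrite /sqabs; case: z => x y /=; rewrite !sqrrN. Qed.

Lemma sqabs_real (x : R) : sqabs x%:C%C = x ^+ 2.
Proof. by rewrite /sqabs /= expr0n addr0. Qed.

Lemma sqabsD z w : sqabs (z + w) <= 2 * (sqabs z + sqabs w).
Proof.
rewrite /sqabs; case: z => x y; case: w => x' y' /=.
have := sqr_ge0 (x - x'); have := sqr_ge0 (y - y'); nra.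
Qed.

End SquaredModulus.

(* A quasi-triangle inequality with constant 2 is all that is used of the
   Hilbert norms below. *)
Record quadratic (R : realType) (V : vectType R[i]) (f : V -> R) : Prop :=
  Quadratic {
    quadraticZ : forall c u, f (c *: u) = sqabs c * f u;
    quadraticD : forall u w, f (u + w) <= 2 * (f u + f w);
    quadratic_ge0 : forall u, 0 <= f u }.

(** The square of a fixed Euclidean norm, against which all other norms are compared. *)
Definition coord_norm (R : realType) (V : vectType R[i]) (u : V) : R :=
  \sum_i sqabs (coord (vbasis {:V}) i u).

Section CoordinateNorm.
Variables (R : realType) (V : vectType R[i]).
Implicit Types (u w : V) (f : V -> R).

Lemma quadratic0 f : quadratic f -> f 0 = 0.
Proof. by move=> qf; rewrite -(scale0r 0) (quadraticZ qf) sqabs0 mul0r. Qed.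

Lemma quadraticN f u : quadratic f -> f (- u) = f u.
Proof.
by move=> qf; rewrite -scaleN1r (quadraticZ qf) sqabsN sqabs1 mul1r.
Qed.

Lemma quadraticB f u w : quadratic f -> f (u - w) <= 2 * (f u + f w).
Proof. by move=> qf; rewrite -[f w](quadraticN _ qf); exact: quadraticD. Qed.

Lemma quadratic_coord_norm : quadratic (@coord_norm R V).
Proof.
split=> [c u|u w|u].
- by rewrite mulr_sumr; apply: eq_bigr => i _; rewrite linearZ /= sqabsM.
- rewrite -big_split /= mulr_sumr; apply: ler_sum => i _.
  by rewrite linearD sqabsD.
- by apply: sumr_ge0 => i _; exact: sqabs_ge0.
Qed.

Lemma sqabs_coord_le u i : sqabs (coord (vbasis {:V}) i u) <= coord_norm u.
Proof.
rewrite /coord_norm (bigD1 i)//= lerDl.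
by apply: sumr_ge0 => k _; exact: sqabs_ge0.
Qed.

Lemma coord_norm_gt0 u : u != 0 -> 0 < coord_norm u.
Proof.
move=> u0; rewrite lt_def (quadratic_ge0 quadratic_coord_norm) andbT.
apply: contra u0 => /eqP q0.
rewrite (coord_vbasis (memvf u)) big1// => i _.
have : sqabs (coord (vbasis {:V}) i u) <= 0 by rewrite -q0 sqabs_coord_le.
by rewrite leNgt sqabs_gt0 negbK => /eqP ->; rewrite scale0r.
Qed.

(** Expanding [u] in the basis applies the quasi-triangle inequality [\dim {:V}] times, whence the
    power of 2. *)
Lemma quadratic_le_coord_norm f : quadratic f ->
  exists2 C, 0 < C & forall u, f u <= C * coord_norm u.
Proof.
move=> qf; set b := vbasis {:V}.
pose F := \sum_(i < \dim {:V}) f b`_i.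
have F0 : 0 <= F by apply: sumr_ge0 => i _; exact: (quadratic_ge0 qf).
(* The summand 1 keeps the constant positive when [f] vanishes on the basis. *)
exists (2 ^+ (\dim {:V}) * F + 1) => [|u].
  by rewrite ltr_wpDl// mulr_ge0// exprn_ge0.
have sum_le (I : Type) (s : seq I) (g : I -> V) :
    f (\sum_(i <- s) g i) <= 2 ^+ size s * \sum_(i <- s) f (g i).
  elim: s => [|i s IH]; first by rewrite !big_nil (quadratic0 qf) mulr0.
  rewrite !big_cons /= exprS -mulrA.
  apply: (le_trans (quadraticD qf _ _)); rewrite ler_pM2l// mulrDr lerD//.
  by rewrite ler_peMl ?(quadratic_ge0 qf)// exprn_ege1// ler1n.
rewrite {1}(coord_vbasis (memvf u)).
apply: (le_trans (sum_le _ _ _)).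
rewrite /index_enum -enumT size_enum_ord mulrDl mul1r.
apply: (@le_trans _ _ (2 ^+ \dim {:V} * F * coord_norm u)); last first.
  by rewrite lerDl (quadratic_ge0 quadratic_coord_norm).
rewrite -mulrA ler_wpM2l ?exprn_ge0// enumT mulr_suml; apply: ler_sum => i _.
rewrite (quadraticZ qf) mulrC.
by rewrite ler_wpM2l ?(quadratic_ge0 qf)// sqabs_coord_le.
Qed.

Lemma quadratic_functional (v : 'Hom(V, (R[i])^o)) :
  quadratic (fun u => sqabs (v u)).
Proof.
split=> [c u|u w|u]; last exact: sqabs_ge0.
- by rewrite linearZ sqabsM.
- by rewrite linearD sqabsD.
Qed.

End CoordinateNorm.

(** * Compactness in finite dimension, along ultrafilters *)

Section UltrafilterLimits.
Variables (R : realType) (T : Type) (G : set_system T).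
Context {GU : UltraFilter G}.

(** The image of [G] under [f] is an ultrafilter containing the compact segment [-1, 1], hence
    converges. Squares in the conclusion let real and imaginary parts add up to [sqabs]. *)
Lemma ultra_cvg_bounded (f : T -> R) :
  G [set t | `|f t| <= 1] ->
  exists l, forall e, 0 < e -> G [set t | (f t - l) ^+ 2 < e].
Proof.
move=> Gf; pose F := f @ G.
have FU : UltraFilter F.
  split; first exact: (@fmap_proper_filter _ _ f G (@ultra_proper _ G GU)).
  move=> K KF FK; rewrite predeqE => A; split=> [KA|]; last exact: FK.
  have [//|GnA] := in_ultra_setVsetC (f @^-1` A) GU.
  have := FK _ (GnA : F (~` A)) => KnA.
  have : K set0 by rewrite -(setICr A); exact: filterI.
  by move=> /filter_not_empty.
have cpt : compact `[(-1 : R), 1] by exact: segment_compact.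
move: cpt; rewrite compact_ultra => /(_ F FU) [].
  apply: (@filterS _ G _ [set t | `|f t| <= 1]) Gf => t /=.
  by rewrite in_itv /= ler_norml.
move=> l [_ Fl]; exists l => e e0.
(* A distance below both 1 and [e] has its square below [e]. *)
have GB : G (f @^-1` ball l (Num.min 1 e)).
  by apply: Fl; apply: nbhsx_ballx; rewrite lt_min ltr01 e0.
apply: filterS GB => t; rewrite /ball /= lt_min => /andP[h1 h2].
rewrite -real_normK ?num_real// distrC expr2.
by apply: (@le_lt_trans _ _ `|l - f t|) => //; rewrite ler_piMr// ltW.
Qed.

Lemma ultra_cvg_coord_norm (V : vectType R[i]) (x : T -> V) :
  G [set t | coord_norm (x t) <= 1] ->
  exists w, forall e, 0 < e -> G [set t | coord_norm (x t - w) < e].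
Proof.
move=> Gx; set b := vbasis {:V}.
have Gc i : G [set t | sqabs (coord b i (x t)) <= 1].
  by apply: filterS Gx => t; apply: le_trans; exact: sqabs_coord_le.
have le1 (a c : R) : a ^+ 2 + c ^+ 2 <= 1 -> `|a| <= 1 /\ `|c| <= 1.
  by move=> ac; split; rewrite -(@expr_le1 _ 2)// real_normK ?num_real//; nra.
have /choice[l lP] : forall i, exists l : R[i],
    forall e, 0 < e -> G [set t | sqabs (coord b i (x t) - l) < e].
  move=> i.
  have [|r rP] := @ultra_cvg_bounded (fun t => complex.Re (coord b i (x t))).
    by apply: filterS (Gc i) => t /le1[].
  have [|s sP] := @ultra_cvg_bounded (fun t => complex.Im (coord b i (x t))).
    by apply: filterS (Gc i) => t /le1[].
  exists (r +i* s)%C => e e0; have e2 : 0 < e / 2 by rewrite divr_gt0.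
  apply: filterS2 (rP _ e2) (sP _ e2) => t /=.
  by rewrite /sqabs; case: (coord b i (x t)) => p q /=; lra.
exists (\sum_i l i *: b`_i) => e e0.
(* Dividing by the dimension plus 1 keeps the sum of the squared coordinate errors strictly below
   [e], also in dimension 0. *)
have n0 : 0 < e / (\dim {:V}).+1%:R by rewrite divr_gt0.
have Gall : G [set t | forall i, sqabs (coord b i (x t) - l i) < e / (\dim {:V}).+1%:R].
  by apply: filter_forall => i; exact: lP.
apply: filterS Gall => t xl /=.
apply: (@le_lt_trans _ _ (\sum_(i < \dim {:V}) e / (\dim {:V}).+1%:R)).
  apply: ler_sum => i _; rewrite linearB /= coord_sum_free ?(ltW (xl i))//.
  exact: basis_free (vbasisP _).
rewrite sumr_const card_ord -mulrnAr -[X in _ < X]mulr1 ltr_pM2l//.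
by rewrite -mulr_natr mulrC ltr_pdivrMr// mul1r ltr_nat.
Qed.

End UltrafilterLimits.

Lemma ultraI (T : Type) (G : set_system T) (GU : UltraFilter G) P Q :
  G P -> G Q -> G (P `&` Q).
Proof. exact: filterI. Qed.

(** * Log-convex families of squared norms and their growth *)

Record log_convex_family (R : realType) (V : vectType R[i]) (h : R -> V -> R)
    : Prop := LogConvexFamily {
  family_quadratic : forall t, 0 < t -> quadratic (h t);
  family_gt0 : forall t u, 0 < t -> u != 0 -> 0 < h t u;
  family_convex : forall u a t b, u != 0 -> 0 < a -> a < t -> t < b ->
    (b - a) * ln (h t u) <= (b - t) * ln (h a u) + (t - a) * ln (h b u) }.

(** Only growth at infinity is measured. For a log-convex family and [u != 0], the least such [b] is
    the rate alpha(u) that defines the filtration. *)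
Definition growth_le (R : realType) (V : Type) (h : R -> V -> R) (u : V)
    (b : R) : Prop :=
  exists C, forall t, 1 <= t -> h t u <= C * expR (b * t).

Section Normalization.
Variables (R : realType) (V : vectType R[i]).
Implicit Types u : V.

Definition normalize u : V := ((Num.sqrt (coord_norm u))^-1)%:C%C *: u.

Lemma quadratic_normalize f u : quadratic f ->
  f (normalize u) = f u / coord_norm u.
Proof.
move=> qf; rewrite (quadraticZ qf) sqabs_real exprVn sqr_sqrtr 1?mulrC//.
exact: (quadratic_ge0 (quadratic_coord_norm V)).
Qed.

Lemma coord_norm_normalize u : u != 0 -> coord_norm (normalize u) = 1.
Proof.
move=> u0; rewrite (quadratic_normalize _ (quadratic_coord_norm V)).
by rewrite divff// gt_eqF// coord_norm_gt0.
Qed.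

(** Compactness of the unit sphere: otherwise there are unit vectors [x T] with [f (x T)] below 1/T,
    and their limit [w] has [f w <= 0], so it is 0 although the [x T] have length 1. *)
Lemma definite_ge_coord_norm f : quadratic f -> (forall u, u != 0 -> 0 < f u) ->
  exists2 c, 0 < c & forall u, c * coord_norm u <= f u.
Proof.
move=> qf fgt0; apply: contrapT => nlow.
have /choice[x xP] : forall T : R, exists u : V,
    0 < T -> coord_norm u = 1 /\ f u < T^-1.
  move=> T; have [T0|T0] := ltP 0 T; last by exists 0.
  apply: contrapT => nx; apply: nlow; exists T^-1; first by rewrite invr_gt0.
  move=> u; have [->|u0] := eqVneq u 0.
    by rewrite (quadratic0 (quadratic_coord_norm V)) (quadratic0 qf) mulr0.
  rewrite leNgt; apply/negP => fu; apply: nx; exists (normalize u) => _.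
  rewrite coord_norm_normalize//; split => //.
  by rewrite quadratic_normalize// ltr_pdivrMr ?coord_norm_gt0.
have [G [GU sG]] := ultraFilterLemma (@proper_pinfty_nbhs R).
have Ginf M : G [set T | M < T] by apply: sG; exact: (nbhs_pinfty_gt (num_real M)).
have [w wP] : exists w, forall e, 0 < e -> G [set T | coord_norm (x T - w) < e].
  apply: ultra_cvg_coord_norm.
  by apply: filterS (Ginf 0) => T /= /xP[->].
have [C C0 fC] := quadratic_le_coord_norm qf.
(* Continuity takes the form f w <= 2 (f (x T) + f (x T - w)), where both terms in the parentheses
   are at most e/4. *)
have fw0 : f w <= 0.
  apply/ler_addgt0Pl => e e0; rewrite addr0.
  have e4 : 0 < e / (4 * C) by rewrite divr_gt0 // mulr_gt0.
  have /filter_ex[T /= [[T0 Te] xw]] :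
      G ([set T | 0 < T] `&` [set T | 4 / e < T]
         `&` [set T | coord_norm (x T - w) < e / (4 * C)]).
    by exact: (ultraI GU (ultraI GU (Ginf _) (Ginf _)) (wP _ e4)).
  have [_ fx] := xP T T0.
  have -> : w = x T - (x T - w) by rewrite subKr.
  apply: (le_trans (quadraticB _ _ qf)).
  have := fC (x T - w); rewrite -lter_pdivlMl// => fxw.
  have : C * coord_norm (x T - w) <= e / 4.
    rewrite -ler_pdivlMl//; apply: (le_trans (ltW xw)).
    by rewrite invfM mulrA mulrC.
  have : T^-1 < e / 4.
    by rewrite invf_plt ?posrE ?divr_gt0// invf_div.
  have := fC (x T - w); lra.
have w0 : w = 0.
  by apply/eqP; apply: contraTT fw0 => /fgt0; rewrite -ltNge.
have /filter_ex[T /= [T0]] :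
    G ([set T | 0 < T] `&` [set T | coord_norm (x T - w) < 1]).
  exact: (ultraI GU (Ginf 0) (wP 1 ltr01)).
by have [q1 _] := xP T T0; rewrite w0 subr0 q1 ltxx.
Qed.

End Normalization.

(** A chord of slope greater than [b] would, by convexity, push [phi] above the affine bound at a
    far time [r]. *)
Lemma convex_affine_bound (R : realType) (phi : R -> R) (A b : R) :
  (forall a t c, 0 < a -> a < t -> t < c ->
    (c - a) * phi t <= (c - t) * phi a + (t - a) * phi c) ->
  (forall t, 1 <= t -> phi t <= A + b * t) ->
  forall s t, 0 < s -> s < t -> phi t <= phi s + b * (t - s).
Proof.
move=> conv bnd s t s0 st; rewrite leNgt; apply/negP => lt_phi.
pose m := phi t - phi s - b * (t - s).
have m0 : 0 < m by rewrite /m; lra.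
pose X := A + s * b - phi s.
(* [m] is the excess at [t] and [X] the gap between the affine bound and [phi] at [s]. Convexity
   would give (r - s) m <= (t - s) X, which this [r] violates. *)
pose r := t + 1 + (t - s) * `|X| / m.
have r0 : 0 <= (t - s) * `|X| / m.
  by rewrite divr_ge0 ?mulr_ge0// ?ltW// subr_gt0.
have tr : t < r by rewrite /r; lra.
have := conv s t r s0 st tr.
have := bnd r _; have -> : 1 <= r by rewrite /r; lra.
move=> /(_ isT) br cv.
have le1 : (t - s) * phi r <= (t - s) * (A + b * r).
  by rewrite ler_pM2l// subr_gt0.
have le2 : (t - s) * X <= (t - s) * `|X| by rewrite ler_wpM2l ?ler_norm// subr_ge0 ltW.
have eq3 : (r - s) * m = (t - s + 1) * m + (t - s) * `|X|.
  by rewrite /r; field; rewrite gt_eqF.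
have : 0 < (t - s + 1) * m by rewrite mulr_gt0//; lra.
have eq4 : (r - s) * phi t = (r - s) * (phi s + b * (t - s)) + (r - s) * m.
  by rewrite /m; ring.
move: le2; rewrite {1}/X; lra.
Qed.

Lemma le_expR_eventually (R : realType) (C e : R) : 0 < e ->
  exists M, forall t, M < t -> C <= expR (e * t).
Proof.
move=> e0; exists (C / e) => t; rewrite ltr_pdivrMr// mulrC => Ct.
by apply: (le_trans _ (expR_ge1Dx _)); rewrite (le_trans (ltW Ct))// lerDr.
Qed.

(** * Decay of the dual norm *)

Section GrowthOfFamilies.
Variables (R : realType) (V : vectType R[i]) (h : R -> V -> R).
Hypothesis hF : log_convex_family h.
Implicit Types u w : V.

(** An exponential bound at infinity forces every chord of [ln (h t u)] to have slope at most [b].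
    The unknown constant disappears, and the condition becomes closed in [b]. *)
Lemma growth_leP u b : u != 0 ->
  growth_le h u b <->
  forall s t, 0 < s -> s < t -> ln (h t u) <= ln (h s u) + b * (t - s).
Proof.
move=> u0; split=> [[C hC]|slope].
  have C0 : 0 < C.
    rewrite -(pmulr_lgt0 _ (expR_gt0 (b * 1))).
    by apply: lt_le_trans (hC 1 _) => //; exact: (family_gt0 hF).
  apply: (@convex_affine_bound _ (fun t => ln (h t u)) (ln C)) => [a t c|t t1].
    exact: (family_convex hF).
  have ht0 : 0 < h t u by apply: (family_gt0 hF) => //; exact: lt_le_trans t1.
  rewrite -ler_expR lnK ?posrE// expRD lnK ?posrE//; exact: hC.
exists (h 1 u * expR (- b)) => t; rewrite le_eqVlt => /orP[/eqP<-|t1].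
  by rewrite -mulrA -expRD mulr1 addNr expR0 mulr1.
have h1 : 0 < h 1 u by exact: (family_gt0 hF).
have ht0 : 0 < h t u by apply: (family_gt0 hF) => //; exact: lt_trans t1.
have := slope 1 t ltr01 t1; rewrite -ler_expR lnK ?posrE// => /le_trans; apply.
by rewrite expRD lnK ?posrE// -mulrA -expRD ler_pM2l// ler_expR; lra.
Qed.

(** Fix [t]. For T > t, convexity between 1 and T bounds [h t (x T)] independently of T: at time 1
    the unit vectors have bounded norm, at time T the hypothesis applies. The bound then passes to
    the limit [w]. *)
Lemma growth_le_limit (G : set_system R) (GU : UltraFilter G) (x : R -> V) w d :
  (forall M, G [set T | M < T]) ->
  G [set T | coord_norm (x T) = 1] ->
  (forall e, 0 < e -> G [set T | coord_norm (x T - w) < e]) ->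
  G [set T | h T (x T) <= expR (d * T)] -> growth_le h w d.
Proof.
move=> Ginf Gx Gw Gh.
have [C1 C10 hC1] := quadratic_le_coord_norm (family_quadratic hF ltr01).
(* The chord from (1, L) to (T, dT) lies below L + |d| + dt on [1, T], so 2|d| leaves room. The
   factor 4 below comes from the quasi-triangle inequality for w = x T - (x T - w). *)
pose L := `|ln C1|; pose K := expR (L + 2 * `|d|).
exists (4 * K) => t t1; have t0 : 0 < t by exact: lt_le_trans t1.
have [Ct Ct0 hCt] := quadratic_le_coord_norm (family_quadratic hF t0).
have K0 : 0 < K * expR (d * t) by rewrite mulr_gt0 ?expR_gt0.
have e0 : 0 < K * expR (d * t) / Ct by rewrite divr_gt0.
have /filter_ex[T /= [[[tT x1] xw] hx]] :
    G ([set T | t < T] `&` [set T | coord_norm (x T) = 1]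
       `&` [set T | coord_norm (x T - w) < K * expR (d * t) / Ct]
       `&` [set T | h T (x T) <= expR (d * T)]).
  by exact: (ultraI GU (ultraI GU (ultraI GU (Ginf _) Gx) (Gw _ e0)) Gh).
have T0 : 0 < T by exact: lt_trans tT.
have x0 : x T != 0.
  apply: contra_eq_neq x1 => ->.
  by rewrite (quadratic0 (quadratic_coord_norm V)) eq_sym oner_eq0.
have L0 : 0 <= L by exact: normr_ge0.
have phi1 : ln (h 1 (x T)) <= L.
  apply: le_trans (ler_norm (ln C1)).
  rewrite ler_ln ?posrE//; last exact: (family_gt0 hF).
  by rewrite (le_trans (hC1 _))// x1 mulr1.
have phiT : ln (h T (x T)) <= d * T.
  by rewrite -ler_expR lnK// posrE; exact: (family_gt0 hF).
have htx : h t (x T) <= K * expR (d * t).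
  rewrite -expRD -[h t _]lnK ?posrE ?ler_expR; last exact: (family_gt0 hF).
  have d1 := ler_norm d; have d2 := ler_norm (- d); rewrite normrN in d2.
  move: t1; rewrite le_eqVlt => /orP[/eqP<-|t1]; first by lra.
  have T1 : 0 < T - 1 by lra.
  rewrite -(ler_pM2l T1).
  apply: (le_trans (family_convex hF x0 ltr01 t1 tT)).
  have p1 : (T - t) * ln (h 1 (x T)) <= (T - t) * L by rewrite ler_pM2l ?subr_gt0.
  have p2 : (t - 1) * ln (h T (x T)) <= (t - 1) * (d * T).
    by rewrite ler_pM2l ?subr_gt0.
  have p3 : 0 <= (t - 1) * L by rewrite mulr_ge0// subr_ge0 ltW.
  have p4 : - d * (T - t) <= `|d| * (T - t) by rewrite ler_wpM2r// subr_ge0 ltW.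
  have p5 : 0 <= `|d| * (t - 1) by rewrite mulr_ge0// subr_ge0 ltW.
  have p6 : 0 <= `|d| * (T - 1) by rewrite mulr_ge0// ltW.
  have -> : (T - 1) * (L + 2 * `|d| + d * t) =
     (T - t) * L + (t - 1) * (d * T) + (t - 1) * L + d * (T - t)
     + `|d| * (T - t) + `|d| * (t - 1) + `|d| * (T - 1) by ring.
  lra.
have -> : w = x T - (x T - w) by rewrite subKr.
apply: (le_trans (quadraticB _ _ (family_quadratic hF t0))).
have : h t (x T - w) <= K * expR (d * t).
  by rewrite (le_trans (hCt _))// -ler_pdivlMl// mulrC ltW.
lra.
Qed.

(** By [growth_leP] every chord slope is a lower bound of the admissible exponents, and so their
    infimum is itself admissible. *)
Lemma growth_rate_inf w d0 : w != 0 -> growth_le h w d0 ->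
  exists2 s, growth_le h w s & forall d, growth_le h w d -> s <= d.
Proof.
move=> w0 wd0; pose D : set R := [set d | growth_le h w d].
have lbD s t : 0 < s -> s < t -> lbound D ((ln (h t w) - ln (h s w)) / (t - s)).
  move=> s0 st d /(growth_leP _ w0)/(_ s t s0 st).
  by rewrite ler_pdivrMr ?subr_gt0// lerBlDl.
exists (inf D).
  apply/(growth_leP _ w0) => s t s0 st.
  have : (ln (h t w) - ln (h s w)) / (t - s) <= inf D.
    by apply: lb_le_inf (lbD s t s0 st); exists d0.
  by rewrite ler_pdivrMr ?subr_gt0// lerBlDl.
move=> d wd; apply: ge_inf => //.
by exists ((ln (h 2 w) - ln (h 1 w)) / (2 - 1)); apply: lbD; rewrite ?ltr1n.
Qed.

(** Let [s] be the exact rate of [w]. If the comparison failed, [h T (x T)] would be at most a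
    constant times e^{(s-e)T}, and [growth_le_limit] would give [w] a rate smaller than [s]. *)
Lemma growth_limit_comparison (G : set_system R) (GU : UltraFilter G)
    (x : R -> V) w d e :
  (forall M, G [set T | M < T]) ->
  G [set T | coord_norm (x T) = 1] ->
  (forall e, 0 < e -> G [set T | coord_norm (x T - w) < e]) ->
  w != 0 -> growth_le h w d -> 0 < e ->
  G [set T | h T w <= expR (e * T) * h T (x T)].
Proof.
move=> Ginf Gx Gw w0 wd e0.
have [s /growth_leP ws s_min] := growth_rate_inf w0 wd.
have [//|Gn] := in_ultra_setVsetC [set T | h T w <= expR (e * T) * h T (x T)] GU.
have : growth_le h w (s - e / 2).
  have e2 : 0 < e / 2 by rewrite divr_gt0.
  (* Half of [e] absorbs the constant, the other half lowers the rate. *)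
  have [M MP] := le_expR_eventually (h 1 w * expR (- s)) e2.
  apply: (growth_le_limit GU Ginf Gx Gw).
  apply: filterS (ultraI GU Gn (ultraI GU (Ginf M) (Ginf 1))) => T /= [nT [MT T1]].
  move/negP : nT; rewrite -ltNge => nT.
  have h1 : 0 < h 1 w by exact: (family_gt0 hF).
  have hT0 : 0 < h T w by apply: (family_gt0 hF) => //; exact: lt_trans T1.
  have hT : h T w <= h 1 w * expR (- s) * expR (s * T).
    have := ws w0 1 T ltr01 T1; rewrite -ler_expR lnK ?posrE// => /le_trans; apply.
    by rewrite expRD lnK ?posrE// -mulrA -expRD ler_pM2l// ler_expR; lra.
  rewrite -(ler_pM2l (expR_gt0 (e * T))) (le_trans (ltW nT))// (le_trans hT)//.
  have -> : expR (e * T) * expR ((s - e / 2) * T) = expR (e / 2 * T) * expR (s * T).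
    by rewrite -!expRD; congr expR; field.
  by rewrite ler_pM2r ?expR_gt0// MP.
by move=> /s_min; lra.
Qed.

Variables (v : 'Hom(V, (R[i])^o)) (g : R).
Hypothesis v_slow : forall u b, b < g -> growth_le h u b -> v u = 0.

(* Rescaled, the vectors u T have a limit w which, growing slowly, is killed by
   v; removing from u T its w-component costs only a subexponential factor and
   makes one more coordinate vanish. *)
Lemma no_fast_dual_sequence (G : set_system R) (GU : UltraFilter G) :
  (forall M, G [set T | M < T]) ->
  forall n (A : {set 'I_(\dim {:V})}) (b : R) (u : R -> V),
    (#|~: A| <= n)%N -> b < g ->
    ~ G [set T | [/\ v (u T) = 1, h T (u T) <= expR (b * T) &
                  forall i, i \in A -> coord (vbasis {:V}) i (u T) = 0]].
Proof.
move=> Ginf; elim=> [|n IH] A b u; last first.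
  move=> cardA bg Gu; set B := vbasis {:V} in Gu.
  pose x T := normalize (u T).
  have qu : quadratic (@coord_norm R V) := quadratic_coord_norm V.
  have [K K0 vK] := quadratic_le_coord_norm (quadratic_functional v).
  have u0 T : v (u T) = 1 -> u T != 0.
    by move=> vu; apply: contra_eq_neq vu => ->; rewrite linear0 eq_sym oner_eq0.
  have Gx : G [set T | coord_norm (x T) = 1].
    by apply: filterS Gu => T [/u0 uT _ _]; exact: coord_norm_normalize.
  have [w Gw] : exists w, forall e, 0 < e -> G [set T | coord_norm (x T - w) < e].
    by apply: ultra_cvg_coord_norm; apply: filterS Gx => T /= ->.
  have w0 : w != 0.
    apply/negP => /eqP w0.
    have /filter_ex[T /= []] : G ([set T | coord_norm (x T) = 1]
        `&` [set T | coord_norm (x T - w) < 1]) by exact: (ultraI GU Gx (Gw _ ltr01)).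
    by rewrite w0 subr0 => ->; rewrite ltxx.
  have wA i : i \in A -> coord B i w = 0.
    move=> iA; apply/eqP; rewrite -[_ == _]negbK -sqabs_gt0.
    apply/negP => /Gw Gi; have /filter_ex[T [[_ _ uA] /=]] := ultraI GU Gu Gi.
    apply/negP; rewrite -leNgt; apply: le_trans (sqabs_coord_le _ i).
    by rewrite linearB linearZ /= uA// ?(scaler0, mulr0) sub0r sqabsN.
  (* From 1 = |v(u T)|^2 <= K |u T|^2, normalizing costs at most the factor [K], absorbed by raising
     the exponent from [b] to the midpoint of [b] and [g]. *)
  have wd : growth_le h w ((b + g) / 2).
    apply: (growth_le_limit GU Ginf Gx Gw).
    have e0 : 0 < (g - b) / 2 by lra.
    have [M MP] := le_expR_eventually K e0.
    apply: filterS (ultraI GU Gu (ultraI GU (Ginf M) (Ginf 0))) => T.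
    move=> [[vu hu _] [/MP KM T0]].
    have q0 := coord_norm_gt0 (u0 _ vu).
    rewrite /= (quadratic_normalize _ (family_quadratic hF T0)) ler_pdivrMr//.
    have := vK (u T); rewrite vu sqabs1 => Kq.
    apply: (le_trans hu).
    have -> : (b + g) / 2 * T = b * T + (g - b) / 2 * T by field.
    rewrite expRD -[leRHS]mulrA -[leLHS]mulr1 ler_pM2l ?expR_gt0//.
    by rewrite (le_trans Kq)// ler_wpM2r// ltW.
  have vw : v w = 0 by apply: v_slow wd; lra.
  have [i wi] : exists i, coord B i w != 0.
    apply: contrapT => /forallNP wz; move/negP: w0; apply; apply/eqP.
    rewrite (coord_vbasis (memvf w)) big1// => i _.
    by have /negP := wz i; rewrite negbK => /eqP ->; rewrite scale0r.
  have iA : i \notin A by apply: contra wi => /wA ->.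
  (* The new exponent b + 2e stays below [g]: one factor e^{eT} pays for comparing [w] with [x T],
     the other absorbs the constant 2 (1 + 1/s). *)
  pose e := (g - b) / 4; have e0 : 0 < e by rewrite /e; lra.
  pose u' T := u T - (coord B i (u T) / coord B i w) *: w.
  apply: (IH (i |: A) (b + 2 * e) u').
  - rewrite -ltnS (leq_trans _ cardA)// proper_card// finset.setCU.
    apply/properP; split; first exact: finset.subsetIr.
    by exists i; rewrite !inE// eqxx.
  - by rewrite /e; lra.
  have s0 : 0 < sqabs (coord B i w) by rewrite sqabs_gt0.
  pose s := sqabs (coord B i w).
  have [M MP] := le_expR_eventually (2 * (1 + s^-1)) e0.
  have Gc := growth_limit_comparison GU Ginf Gx Gw w0 wd e0.
  apply: filterS (ultraI GU (ultraI GU Gu Gc) (ultraI GU (Ginf M) (Ginf 0))) => T.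
  move=> [[[vu hu uA] /= hc] [/MP MT T0]]; split.
  - by rewrite linearB linearZ /= vu vw ?(scaler0, mulr0) subr0.
  - have qT := family_quadratic hF T0.
    apply: (le_trans (quadraticB _ _ qT)).
    rewrite (quadraticZ qT) sqabsM sqabsV.
    have q0 := coord_norm_gt0 (u0 _ vu).
    rewrite /x (quadratic_normalize _ qT) in hc.
    have E0 : 1 <= expR (e * T) by rewrite -(expR0 R) ler_expR mulr_ge0// ltW.
    (* The squared coordinate is at most |u T|^2, which cancels the division by |u T|^2 in [hc]. *)
    have p1 : sqabs (coord B i (u T)) / s * h T w <=
        s^-1 * expR (e * T) * h T (u T).
      apply: (@le_trans _ _ (coord_norm (u T) / s *
          (expR (e * T) * (h T (u T) / coord_norm (u T))))).
        apply: ler_pM => //; first by rewrite divr_ge0// sqabs_ge0.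
          exact: (quadratic_ge0 qT).
        by rewrite ler_pM2r ?invr_gt0//; exact: sqabs_coord_le.
      by rewrite le_eqVlt; apply/orP; left; apply/eqP; field; rewrite !gt_eqF.
    have -> : (b + 2 * e) * T = e * T + e * T + b * T by ring.
    rewrite 2!expRD.
    have hu0 := quadratic_ge0 qT (u T).
    apply: (@le_trans _ _ (2 * (1 + s^-1) * expR (e * T) * h T (u T))).
      rewrite -/s; have : h T (u T) <= expR (e * T) * h T (u T) by rewrite ler_peMl.
      lra.
    apply: ler_pM => //.
      by rewrite mulr_ge0 ?expR_ge0// mulr_ge0// addr_ge0// invr_ge0 ltW.
    by rewrite ler_wpM2r ?expR_ge0.
  - move=> k; rewrite !inE linearB linearZ /= => /orP[/eqP ->|kA].
      by rewrite divfK// subrr.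
    by rewrite (uA _ kA) (wA _ kA) mulr0 subr0.
(* Base case: all coordinates of [u T] vanish, against [v (u T) = 1]. *)
rewrite leqn0 cards_eq0 => /eqP AC _ /filter_ex[T [vu _ uA]].
have u0 : u T = 0.
  rewrite (coord_vbasis (memvf (u T))) big1// => i _.
  by rewrite uA ?scale0r// -[A]finset.setCK AC !inE.
by move: vu; rewrite u0 linear0 => /eqP; rewrite eq_sym oner_eq0.
Qed.

(** If the estimate fails at arbitrarily large times, rescaling the offending vectors to v u = 1
    gives a sequence excluded by [no_fast_dual_sequence], started with no prescribed vanishing
    coordinate. *)
Lemma dual_decay b : b < g ->
  exists2 T0, 0 < T0 & forall T u, T0 <= T ->
    sqabs (v u) <= expR (- b * T) * h T u.
Proof.
move=> bg; apply: contrapT => nT0.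
pose B := [set T : R | 0 < T /\ exists2 u, v u = 1 & h T u <= expR (b * T)].
have Bunb M : exists2 T, M < T & B T.
  apply: contrapT => nM; apply: nT0; exists (`|M| + 1) => [|T u MT].
    by rewrite ltr_wpDl.
  have T0 : 0 < T by rewrite (lt_le_trans _ MT)// ltr_wpDl.
  rewrite leNgt; apply/negP => lt_v; apply: nM; exists T.
    by rewrite (lt_le_trans _ MT)// ltr_pwDr// ler_norm.
  split=> //; have hT0 := quadratic_ge0 (family_quadratic hF T0) u.
  have vu0 : 0 < sqabs (v u).
    by rewrite (le_lt_trans _ lt_v)// mulr_ge0// expR_ge0.
  exists ((v u)^-1 *: u).
    by rewrite linearZ; apply: mulVf; rewrite -sqabs_gt0.
  rewrite (quadraticZ (family_quadratic hF T0)) sqabsV mulrC ler_pdivrMr//.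
  rewrite -[h T u]mul1r -(expR0 R) -(subrr (b * T)) expRD -mulrA.
  by rewrite ler_pM2l ?expR_gt0// -mulNr ltW.
(* The bad times are unbounded, so this filter is proper and extends to an ultrafilter that tends to
   infinity inside [B]. *)
pose F := within B (pinfty_nbhs R).
have FF : ProperFilter F.
  apply: Build_ProperFilter_ex => P [M [_ MP]].
  by have [T MT BT] := Bunb M; exists T; exact: MP.
have [G [GU sFG]] := ultraFilterLemma FF.
have Ginf M : G [set T | M < T].
  apply: sFG; apply: (@filterS _ (pinfty_nbhs R) _ [set T | M < T]).
    by move=> T MT _.
  exact: (nbhs_pinfty_gt (num_real M)).
have /choice[u uP] : forall T, exists u, B T -> v u = 1 /\ h T u <= expR (b * T).
  move=> T; have [[_ [u vu hu]]|nB] := pselect (B T); first by exists u.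
  by exists 0.
apply: (@no_fast_dual_sequence G GU Ginf _ finset.set0 b u (leqnn _) bg).
have GB : G B by apply: sFG; exact: withinT.
by apply: filterS GB => T /uP[vu hu]; split=> // i; rewrite inE.
Qed.

End GrowthOfFamilies.

(* Unlike [ge0_le_integral], applicable to the dual norm, whose measurability in
   t is then never needed. *)
Lemma ge0_le_integral_nonmeasurable d (T : measurableType d) (R : realType)
    (mu : {measure set T -> \bar R}) (D : set T) (f g : T -> \bar R) :
  (forall x, D x -> (0 <= f x)%E) -> (forall x, D x -> (f x <= g x)%E) ->
  (\int[mu]_(x in D) f x <= \int[mu]_(x in D) g x)%E.
Proof.
move=> f0 fg; have g0 x : D x -> (0 <= g x)%E.
  by move=> Dx; exact: le_trans (f0 _ Dx) (fg _ Dx).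
rewrite !ge0_integralE//; apply: le_ereal_sup => _ [k kf <-]; exists k => // x.
by apply: (le_trans (kf x)); exact: lee_restrict.
Qed.

(** * Sub-mean value inequality and maximum principle *)

Section CircleMeans.
Variable R : realType.
Implicit Types (f g : R -> R).

(** The function lies below the step function equal to M - e on [I] and to M elsewhere, whose mean
    is the right-hand side. Since e <= M, both summands of the step function are nonnegative. *)
Lemma circle_mean_le f (I : set R) (M e l : R) : measurable I ->
  I `<=` `[0%R, (2 * pi)%R] -> lebesgue_measure I = l%:E ->
  0 <= e -> e <= M ->
  (forall x, 0 <= f x) -> (forall x, x \in `[0%R, (2 * pi)%R] -> f x <= M) ->
  (forall x, I x -> f x <= M - e) ->
  ((2 * pi)^-1%:E * \int[lebesgue_measure]_(x in `[0%R, (2 * pi)%R]) (f x)%:E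
    <= (M - e * l / (2 * pi))%:E)%E.
Proof.
move=> mI Isub mul e0 eM f0 fM fI; set D := [set` `[0%R, (2 * pi)%R]].
have pi2 : 0 < 2 * pi :> R by rewrite mulr_gt0// pi_gt0.
have muD : lebesgue_measure D = (2 * pi)%:E :> \bar R.
  by rewrite /D lebesgue_measure_itv /= lte_fin pi2 -EFinD subr0.
have mD : measurable D by exact: measurable_itv.
have le_step : (\int[lebesgue_measure]_(x in D) (f x)%:E <=
   \int[lebesgue_measure]_(x in D) ((cst (M - e)%:E x) + (e%:E * (\1_(~` I) x)%:E)))%E.
  apply: ge0_le_integral_nonmeasurable => x Dx; first by rewrite lee_fin.
  rewrite -EFinM -EFinD lee_fin indicE /=.
  have [xI|xI] := pselect (I x).
    by rewrite memNset ?mulr0 ?addr0; [exact: fI | exact].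
  by rewrite mem_set// mulr1 subrK; exact: fM.
have step : (\int[lebesgue_measure]_(x in D)
    ((cst (M - e)%:E x) + (e%:E * (\1_(~` I) x)%:E)) =
    ((M - e) * (2 * pi) + e * (2 * pi - l))%:E)%E.
  rewrite ge0_integralD//; last 3 first.
  - by move=> x _; rewrite lee_fin subr_ge0.
  - by move=> x _; rewrite mule_ge0// lee_fin.
  - apply: measurable_funeM; apply/measurable_realfun.measurable_EFinP.
    by apply: measurable_realfun.measurable_indic; exact: measurableC.
  rewrite integral_cst// ge0_integralZl//; last first.
    apply/measurable_realfun.measurable_EFinP.
    by apply: measurable_realfun.measurable_indic; exact: measurableC.
  rewrite integral_indic//; last exact: measurableC.
  rewrite [X in (e%:E * X)%E](_ : _ = (2 * pi - l)%:E); last first.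
    rewrite setIC -setDE measureD//; last by rewrite [ltLHS]muD ltry.
    have -> : D `&` I = I by apply/seteqP; split=> [x []//|x Ix]; split=> //; exact: Isub.
    by rewrite [X in (X - _)%E]muD [X in (_ - X)%E]mul -EFinD.
  by rewrite [X in (_ * X + _)%E]muD -!EFinM -EFinD.
apply: (@le_trans _ _ ((2 * pi)^-1%:E * ((M - e) * (2 * pi) + e * (2 * pi - l))%:E)%E).
  by rewrite lee_wpmul2l ?lee_fin ?invr_ge0 ?(ltW pi2)// -step.
rewrite -EFinM lee_fin le_eqVlt; apply/orP; left; apply/eqP.
by move: (pi : R) (pi_gt0 R) => p p0; field; exact: lt0r_neq0.
Qed.

(** Measures an arc near angle 0 and, through cos (x + pi) = - cos x, one near pi. The bound by pi
    keeps both arcs inside [0, 2 pi]. *)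
Lemma cos_near_extrema (d : R) : 0 < d ->
  exists2 e, 0 < e <= pi & forall x, 0 <= x <= e -> 1 - cos x < d.
Proof.
move=> d0; have := @continuous_cos R 0.
move=> /(@cvgrPdist_lt _ _ _ (nbhs (0 : R))) => /(_ d d0).
move=> /nbhs_ballP[e /= e0 he].
exists (Num.min (e / 2) pi).
  by rewrite lt_min divr_gt0//= pi_gt0/= ge_min lexx orbT.
move=> x /andP[x0]; rewrite le_min => /andP[xe _].
have /he /= : ball (0 : R) e x.
  rewrite /ball /= sub0r normrN ger0_norm// (le_lt_trans xe)//.
  by rewrite ltr_pdivrMr// ltr_pMr// ltr1n.
by rewrite cos0 ger0_norm// subr_ge0 cos_le1.
Qed.

(* The disc about t0 of maximal radius touches an end of the strip, so that a
   fixed proportion of its boundary circle lies where g < M - e, for any t0;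
   hence the supremum M over the interior is never approached. *)
Lemma submean_max_principle g (a b B : R) : a < b ->
  (forall t, 0 <= g t) ->
  (forall t, a <= t <= b -> g t <= B) ->
  (forall c, g a < c -> exists2 d, 0 < d & forall t, a <= t < a + d -> g t < c) ->
  (forall c, g b < c -> exists2 d, 0 < d & forall t, b - d < t <= b -> g t < c) ->
  (forall t r, 0 < r -> a <= t - r -> t + r <= b ->
    ((g t)%:E <= (2 * pi)^-1%:E *
      \int[lebesgue_measure]_(x in `[0%R, (2 * pi)%R]) (g (t + r * cos x))%:E)%E) ->
  forall t, a < t < b -> g t <= Num.max (g a) (g b).
Proof.
move=> ab g0 gB usca uscb mean t1 t1ab.
set m := Num.max _ _; rewrite leNgt; apply/negP => mt1.
pose S := g @` `[a, b]; pose M := sup S.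
have supS : has_sup S.
  split; first by exists (g t1); exists t1 => //=; rewrite in_itv /=; lra.
  by exists B => _ [t /= + <-]; rewrite in_itv /=; exact: gB.
have gM t : a <= t <= b -> g t <= M.
  by move=> tab; apply: ub_le_sup; [exact: supS.2|exists t; rewrite //= in_itv].
have mM : m < M by apply: lt_le_trans mt1 _; apply: gM; lra.
pose e := (M - m) / 2; have e0 : 0 < e by rewrite /e; lra.
have m0 : 0 <= m by rewrite /m le_max g0.
have eM : e <= M by rewrite /e; lra.
have ga : g a < M - e.
  have : g a <= m by rewrite /m le_max lexx.
  by rewrite /e; lra.
have gb : g b < M - e.
  have : g b <= m by rewrite /m le_max lexx orbT.
  by rewrite /e; lra.
have [da da0 hda] := usca _ ga; have [db db0 hdb] := uscb _ gb.
(* Radii are at most b - a, so on the arc where 1 - cos is below [d] a circle touching an end stays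
   within [da] or [db] of that end. *)
pose d := Num.min da db / (b - a).
have d0 : 0 < d by rewrite divr_gt0 ?lt_min ?da0// subr_gt0.
have [l /andP[l0 lpi] hl] := cos_near_extrema d0.
have pi0 : 0 < pi :> R by exact: pi_gt0.
have dba : d * (b - a) = Num.min da db by rewrite divfK// gt_eqF// subr_gt0.
have dda : d * (b - a) <= da by rewrite dba ge_min lexx.
have ddb : d * (b - a) <= db by rewrite dba ge_min lexx orbT.
pose k := e * l / (2 * pi).
have k0 : 0 < k by rewrite divr_gt0// mulr_gt0.
have muI (c : R) : lebesgue_measure [set` `[c, c + l]] = l%:E :> \bar R.
  by rewrite lebesgue_measure_itv /= lte_fin ltrDl l0 -EFinD addrAC subrr add0r.
have inner t : a < t < b -> g t <= M - k.
  move=> /andP[at_ tb].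
  have disc r : 0 < r -> a <= t - r -> t + r <= b ->
      forall x, g (t + r * cos x) <= M.
    move=> r0 ar rb x; apply: gM.
    have := cos_geN1 x; have := cos_le1 x.
    rewrite -(ler_pM2l r0) mulr1 => h1; rewrite -(ler_pM2l r0) mulrN1 => h2.
    by apply/andP; split; lra.
  have [tl|tr] := leP (t - a) (b - t).
    have r0 : 0 < t - a by lra.
    have ar : a <= t - (t - a) by lra.
    have rb : t + (t - a) <= b by lra.
    rewrite -lee_fin; apply: (le_trans (mean _ _ r0 ar rb)).
    apply: (@circle_mean_le _ [set` `[pi, pi + l]]) => //.
    - by move=> x /=; rewrite !in_itv /=; lra.
    - exact: ltW.
    - by move=> x _; exact: disc.
    - move=> x /=; rewrite in_itv /= => /andP[x1 x2]; apply/ltW/hda.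
      have := hl (x - pi); have := cosDpi (x - pi); rewrite subrK => -> hx.
      have {}hx : 1 - cos (x - pi) < d by apply: hx; lra.
      have : (t - a) * (1 - cos (x - pi)) < da.
        apply: lt_le_trans dda; rewrite [ltLHS]mulrC.
        have c0 : 0 <= 1 - cos (x - pi) by rewrite subr_ge0 cos_le1.
        by apply: (ltr_pM c0 (ltW r0) hx); lra.
      have : 0 <= (t - a) * (1 - cos (x - pi)).
        by rewrite mulr_ge0 ?(ltW r0)// subr_ge0 cos_le1.
      by move=> *; apply/andP; split; lra.
  have r0 : 0 < b - t by lra.
  have ar : a <= t - (b - t) by lra.
  have rb : t + (b - t) <= b by lra.
  rewrite -lee_fin; apply: (le_trans (mean _ _ r0 ar rb)).
  apply: (@circle_mean_le _ [set` `[0, 0 + l]]) => //.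
  - by move=> x /=; rewrite !in_itv /=; lra.
  - exact: ltW.
  - by move=> x _; exact: disc.
  - move=> x /=; rewrite in_itv /= add0r => /hl hx; apply/ltW/hdb.
    have : (b - t) * (1 - cos x) < db.
      apply: lt_le_trans ddb; rewrite [ltLHS]mulrC.
      have c0 : 0 <= 1 - cos x by rewrite subr_ge0 cos_le1.
      by apply: (ltr_pM c0 (ltW r0) hx); lra.
    have : 0 <= (b - t) * (1 - cos x).
      by rewrite mulr_ge0 ?(ltW r0)// subr_ge0 cos_le1.
    by move=> *; apply/andP; split; lra.
(* The ends lie below M - e and the interior below M - k, so M is not the supremum. *)
have : M <= M - Num.min k e.
  apply: ge_sup; first exact: supS.1.
  move=> _ [t /= + <-]; rewrite in_itv /= => /andP[].
  rewrite le_eqVlt => /orP[/eqP<- _|at_].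
    by rewrite (le_trans (ltW ga))// lerB// ge_min lexx orbT.
  rewrite le_eqVlt => /orP[/eqP->|tb].
    by rewrite (le_trans (ltW gb))// lerB// ge_min lexx orbT.
  by rewrite (le_trans (inner _ _)) ?at_// lerB// ge_min lexx.
have : 0 < Num.min k e by rewrite lt_min k0.
lra.
Qed.

End CircleMeans.

(** * The complex exponential and its holomorphy *)

Definition cexp (R : realType) (z : R[i]) : R[i] :=
  (expR (complex.Re z) * cos (complex.Im z)
    +i* (expR (complex.Re z) * sin (complex.Im z)))%C.

Section ComplexExponential.
Variable R : realType.

Lemma is_derive_linear_approx (f : R -> R) (df e : R) :
  is_derive (0 : R) 1 f df -> 0 < e ->
  exists2 d, 0 < d & forall x, `|x| < d -> `|f x - f 0 - df * x| <= e * `|x|.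
Proof.
move=> [dv dfE] e0.
have cv : (fun h => h^-1 *: ((f \o shift 0) (h *: 1) - f 0)) @ 0^' --> df.
  by rewrite -dfE; exact: dv.
move/(@cvgrPdist_le _ _ _ (0^')) : cv => /(_ e e0).
move=> /nbhs_ballP[d /= d0 hd]; exists d => // x xd.
have [->|x0] := eqVneq x 0; first by rewrite subrr mulr0 subr0 normr0 mulr0.
have /(_ _)/= := hd x; rewrite /ball /= sub0r normrN => /(_ xd x0).
rewrite addr0 /GRing.scale /= mulr1 => le_e.
have -> : f x - f 0 - df * x = - ((df - x^-1 * (f x - f 0)) * x) by field.
by rewrite normrN normrM ler_wpM2r.
Qed.

Lemma cexpD (z w : R[i]) : cexp (z + w) = cexp z * cexp w.
Proof.
case: z => x y; case: w => x' y'; rewrite /cexp /= expRD cosD sinD.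
by apply/eqP; rewrite eq_complex /=; apply/andP; split; apply/eqP; ring.
Qed.

Lemma sqabs_cexp (z : R[i]) : sqabs (cexp z) = expR (2 * complex.Re z).
Proof.
rewrite /sqabs /= !exprMn -mulrDr cos2Dsin2 mulr1 -expRM_natl.
by rewrite mulr_natl.
Qed.

(** Complex differentiability at 0, assembled from the first-order expansions of [expR], [cos] and
    [sin] and written with squared moduli. *)
Lemma cexp_linear_approx (e : R) : 0 < e ->
  exists2 d, 0 < d & forall z : R[i], sqabs z < d ->
    sqabs (cexp z - 1 - z) <= e * sqabs z.
Proof.
(* The squared errors sum to at most e1^2 ((|x| + 2|y|)^2 + 9|y|^2), the bracket is at most 100
   (|x|^2 + |y|^2), and e1^2 <= e1 because e1 <= 1. *)
move=> e_gt0; pose e1 := Num.min 1 (e / 100).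
have e10 : 0 < e1 by rewrite lt_min ltr01 divr_gt0.
have e11 : e1 <= 1 by rewrite ge_min lexx.
have e1e : e1 <= e / 100 by rewrite ge_min lexx orbT.
have [d1 d10 h1] := is_derive_linear_approx (is_derive_expR (0 : R)) e10.
have [d2 d20 h2] := is_derive_linear_approx (is_derive_cos (0 : R)) e10.
have [d3 d30 h3] := is_derive_linear_approx (is_derive_sin (0 : R)) e10.
rewrite expR0 in h1; rewrite cos0 sin0 in h2 h3.
(* The bound e1/2 on |x| gives |e^x - 1| <= e1. *)
pose d := Num.min (Num.min d1 d2) (Num.min d3 (e1 / 2)).
have d0 : 0 < d by rewrite !lt_min d10 d20 d30 divr_gt0.
exists (d ^+ 2) => [|[x y]]; first by rewrite exprn_gt0.
rewrite {1}/sqabs /= => xyd.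
have small (t s : R) : t ^+ 2 + s ^+ 2 < d ^+ 2 -> `|t| < d.
  move=> ts; rewrite -(@ltr_pXn2r _ 2)// ?nnegrE ?(ltW d0)//.
  by rewrite real_normK ?num_real//; have := sqr_ge0 s; lra.
have xd := small _ _ xyd.
have yd : `|y| < d by apply: (small y x); rewrite addrC.
move: xd yd; rewrite !lt_min => /andP[/andP[x1 _] /andP[_ xe]].
move=> /andP[/andP[_ y2] /andP[y3 _]].
have := h1 _ x1; have := h2 _ y2; have := h3 _ y3.
rewrite !mul1r oppr0 mul0r !subr0.
rewrite !ler_norml => /andP[s1 s2] /andP[c1 c2] /andP[x3 x4].
have X0 := normr_ge0 x; have Y0 := normr_ge0 y.
move: xe; rewrite ltr_pdivlMr// => xe.
have XX : `|x| ^+ 2 = x ^+ 2 by rewrite real_normK ?num_real.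
have YY : `|y| ^+ 2 = y ^+ 2 by rewrite real_normK ?num_real.
have eX : e1 * `|x| <= `|x| by rewrite ler_piMl.
have nx : - `|x| <= x <= `|x| by rewrite -ler_norml.
have E0 : 0 <= expR x by exact: expR_ge0.
have Ele : `|expR x - 1| <= e1 by rewrite ler_norml; apply/andP; split; lra.
have E2 : expR x <= 2 by move: Ele; rewrite ler_norml => /andP[]; lra.
have bnd (s : R) : `|s| <= e1 * `|y| -> `|expR x * s| <= 2 * (e1 * `|y|).
  by move=> sy; rewrite normrM ger0_norm//; apply: ler_pM.
have re : `|expR x * cos y - 1 - x| <= e1 * (`|x| + 2 * `|y|).
  have -> : expR x * cos y - 1 - x = expR x * (cos y - 1) + (expR x - 1 - x) by ring.
  have h : `|expR x * (cos y - 1)| <= 2 * (e1 * `|y|).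
    by apply: bnd; rewrite ler_norml; apply/andP; split; lra.
  apply: (le_trans (ler_normD _ _)).
  have : `|expR x - 1 - x| <= e1 * `|x| by rewrite ler_norml x3.
  lra.
have im : `|expR x * sin y - y| <= e1 * (3 * `|y|).
  have -> : expR x * sin y - y = expR x * (sin y - y) + (expR x - 1) * y by ring.
  have h : `|expR x * (sin y - y)| <= 2 * (e1 * `|y|).
    by apply: bnd; rewrite ler_norml; apply/andP; split; lra.
  apply: (le_trans (ler_normD _ _)).
  have : `|(expR x - 1) * y| <= e1 * `|y| by rewrite normrM ler_wpM2r.
  lra.
have sqle (a b : R) : `|a| <= b -> a ^+ 2 <= b ^+ 2.
  by move=> ab; rewrite -(real_normK (num_real a)) lerXn2r ?nnegrE// (le_trans _ ab).
rewrite /sqabs /cexp /= subr0.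
apply: (le_trans (lerD (sqle _ _ re) (sqle _ _ im))).
rewrite !exprMn -XX -YY.
have ee : e1 ^+ 2 <= e / 100 by apply: le_trans e1e; rewrite expr2 ler_piMl// ltW.
have : e1 ^+ 2 * ((`|x| + 2 * `|y|) ^+ 2 + 3 ^+ 2 * `|y| ^+ 2) <=
       e / 100 * ((`|x| + 2 * `|y|) ^+ 2 + 3 ^+ 2 * `|y| ^+ 2).
  by rewrite ler_wpM2r// addr_ge0 ?mulr_ge0 ?sqr_ge0.
have : e / 100 * ((`|x| + 2 * `|y|) ^+ 2 + 3 ^+ 2 * `|y| ^+ 2) <=
       e / 100 * (100 * (`|x| ^+ 2 + `|y| ^+ 2)).
  rewrite ler_wpM2l ?divr_ge0 ?(ltW e_gt0)//.
  have := sqr_ge0 (`|x| - `|y|); have := sqr_ge0 `|x|; have := sqr_ge0 `|y|; lra.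
lra.
Qed.

Lemma normc_lt (z e : Cplx R) : 0 < e -> sqabs z < complex.Re e ^+ 2 -> `|z| < e.
Proof.
case: e => r s; rewrite ltcE /= => /andP[/eqP -> r0] zr.
rewrite normc_def ltcE /= eqxx /= -(@ltr_pXn2r _ 2)// ?nnegrE ?sqrtr_ge0 ?(ltW r0)//.
by rewrite sqr_sqrtr// ?addr_ge0 ?sqr_ge0.
Qed.

Lemma sqabs_lt_normc (z e : Cplx R) : `|z| < e -> sqabs z < complex.Re e ^+ 2.
Proof.
case: e => r s; rewrite normc_def ltcE /= => /andP[_ zr].
have r0 : 0 <= r by rewrite (le_trans (sqrtr_ge0 _) (ltW zr)).
by rewrite -[sqabs z]sqr_sqrtr ?sqabs_ge0// ltr_pXn2r ?nnegrE ?sqrtr_ge0.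
Qed.

(** The functional equation reduces differentiability at [z] to the expansion at 0. *)
Lemma derivable_cexp (c : R) (k z : Cplx R) :
  derivable (fun w : (Cplx R)^o => cexp (c%:C%C * w) * k : (Cplx R)^o) z 1.
Proof.
pose K : Cplx R := cexp (c%:C%C * z) * k.
apply/cvg_ex; exists (K * c%:C%C).
apply/(@cvgrPdist_lt _ (Cplx R)^o _ (0^')) => e e0.
(* The order on [Cplx R] makes a positive [e] a positive real number, recovered by its real part. *)
have e0' : 0 < complex.Re e by move: e0; rewrite ltcE /= => /andP[].
pose e1 := complex.Re e ^+ 2 / ((sqabs K + 1) * (c ^+ 2 + 1)).
have K1 : 0 < sqabs K + 1 by rewrite ltr_wpDl// sqabs_ge0.
have c1 : 0 < c ^+ 2 + 1 by rewrite ltr_wpDl// sqr_ge0.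
have e10 : 0 < e1 by rewrite divr_gt0 ?exprn_gt0// mulr_gt0.
have [d d0 hd] := cexp_linear_approx e10.
pose d1 : R := Num.sqrt (d / (c ^+ 2 + 1)).
have d10 : 0 < d1 by rewrite sqrtr_gt0 divr_gt0.
apply/nbhs_ballP; exists (d1%:C%C : Cplx R); first by rewrite /= ltcR.
move=> h; rewrite /ball /= sub0r normrN => /sqabs_lt_normc /=.
rewrite sqr_sqrtr ?divr_ge0 ?(ltW d0) ?(ltW c1)// => hd1 h0.
have hs : 0 < sqabs h by rewrite sqabs_gt0.
have dist : sqabs (c%:C%C * h) < d.
  rewrite sqabsM sqabs_real; move: hd1; rewrite ltr_pdivlMr//.
  by rewrite mulrDr mulr1 mulrC; lra.
apply: normc_lt => //.
have -> : K * c%:C%C -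
    h^-1 *: (cexp (c%:C%C * (h *: 1 + z)) * k - cexp (c%:C%C * z) * k) =
   - (K * (cexp (c%:C%C * h) - 1 - c%:C%C * h) / h).
  have -> : cexp (c%:C%C * (h *: 1 + z)) = cexp (c%:C%C * h) * cexp (c%:C%C * z).
    by rewrite -cexpD -mulrDr -[h *: 1]/(h * 1) mulr1.
  rewrite -[h^-1 *: _]/(h^-1 * _) /K.
  set p := cexp (_ * h); set q := cexp _; set r := (c%:C)%C.
  by clearbody p q r; field; exact: h0.
rewrite sqabsN sqabsM (sqabsM K) sqabsV ltr_pdivrMr//.
have := hd _ dist; rewrite sqabsM sqabs_real => le1.
apply: (@le_lt_trans _ _ (sqabs K * (e1 * (c ^+ 2 * sqabs h)))).
  by rewrite ler_wpM2l// sqabs_ge0.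
have -> : sqabs K * (e1 * (c ^+ 2 * sqabs h)) = (sqabs K * c ^+ 2 * e1) * sqabs h by ring.
rewrite ltr_pM2r// /e1 mulrA ltr_pdivrMr ?mulr_gt0// mulrC ltr_pM2l ?exprn_gt0//.
have := sqabs_ge0 K; have := sqr_ge0 c.
have -> : (sqabs K + 1) * (c ^+ 2 + 1) = sqabs K * c ^+ 2 + sqabs K + c ^+ 2 + 1 by ring.
lra.
Qed.

Lemma open_right_half_plane : open (@right_half_plane R).
Proof.
rewrite openE => z; rewrite /right_half_plane /interior /= => z0.
apply/nbhs_ballP; exists ((complex.Re z)%:C%C : Cplx R); first by rewrite /= ltcR.
move=> w; rewrite /ball /= => /sqabs_lt_normc /=.
rewrite /sqabs; case: z z0 => x y /= x0; case: w => x' y' /= lt_x.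
have := sqr_ge0 (y - y') => y2.
rewrite ltNge; apply/negP => x'0.
have : x ^+ 2 <= (x - x') ^+ 2 by rewrite lerXn2r ?nnegrE; lra.
lra.
Qed.

End ComplexExponential.

(** * Log-convexity *)

Definition sqform (R : realType) (V : vectType R[i])
    (H : R -> {dot V for Num.conj}) (t : R) (u : V) : R :=
  complex.Re (H t u u).

Section NegativeCurvature.
Variables (R : realType) (V : vectType R[i]) (H : R -> {dot V for Num.conj}).

Lemma form_real t u : H t u u = (sqform H t u)%:C%C.
Proof.
rewrite /sqform; have [->|u0] := eqVneq u 0; first by rewrite linear0r.
have := neq0_dnorm_gt0 (s := H t) u u0.
by case: (H t u u) => x y; rewrite ltcE /= => /andP[/eqP -> _].
Qed.

Lemma sqform_gt0 t u : u != 0 -> 0 < sqform H t u.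
Proof.
move=> u0; have := neq0_dnorm_gt0 (s := H t) u u0.
by rewrite form_real ltcR.
Qed.

Lemma sqform_ge0 t u : 0 <= sqform H t u.
Proof.
have [->|u0] := eqVneq u 0; first by rewrite /sqform linear0r.
by rewrite ltW// sqform_gt0.
Qed.

(** The constant 2 is the parallelogram law with the squared norm of u - w dropped. *)
Lemma sqform_quadratic t : quadratic (sqform H t).
Proof.
split=> [c u|u w|u]; last exact: sqform_ge0.
- rewrite {1}/sqform linearZl_LR linearZr_LR /= mulrA -normCK -add_Re2_Im2.
  by rewrite form_real -rmorphM.
- have : H t (u + w) (u + w) + H t (u - w) (u - w)
      = 2 * (H t u u + H t w w).
    by rewrite hnormD hnormB; ring.
  rewrite !form_real => /(congr1 (@complex.Re R)) /= E.
  by have := sqform_ge0 t (u - w); lra.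
Qed.

Lemma metric_norm_sqr t u : 0 < t -> metric_norm H t u ^+ 2 = sqform H t u.
Proof. by move=> t0; rewrite /metric_norm t0 sqr_sqrtr// sqform_ge0. Qed.

Hypotheses (Hcurv : negative_curvature H) (Hgrowth : moderate_growth H).

(** The section z |-> e^{cz} u is holomorphic, and its squared norm e^{2cx} ||u||_x^2 depends on x =
    Re z only, so subharmonicity gives the one-variable hypotheses of [submean_max_principle].
    Moderate growth gives the upper bound on [a, b]. *)
Lemma exp_twist_max_principle u (c a b t : R) : 0 < a -> a < t -> t < b ->
  expR (2 * (c * t)) * sqform H t u <=
  Num.max (expR (2 * (c * a)) * sqform H a u) (expR (2 * (c * b)) * sqform H b u).
Proof.
move=> a0 at_ tb; pose s (z : Cplx R) : V := cexp (c%:C%C * z) *: u.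
pose g (x : R) := expR (2 * (c * x)) * sqform H x u.
pose F (z : Cplx R) := (metric_norm H (complex.Re z) (s z) ^+ 2)%:E.
have sE z : 0 < complex.Re z -> F z = (g (complex.Re z))%:E.
  move=> z0; rewrite /F metric_norm_sqr// (quadraticZ (sqform_quadratic _)) sqabs_cexp.
  by congr (expR (2 * _) * _)%:E; case: z {z0} => x y /=; rewrite mul0r subr0.
have hol : holomorphic (@right_half_plane R) s.
  move=> i z _; set k := coord (vbasis {:V}) i u.
  rewrite [X in derivable X](_ : _ =
      (fun w : (Cplx R)^o => cexp (c%:C%C * w) * k : (Cplx R)^o)).
    exact: derivable_cexp.
  by apply/funext => w; rewrite /s linearZ.
have [_ usc mean] := Hcurv (@open_right_half_plane R) (@subset_refl _ _) hol.
have g0 x : 0 <= g x by rewrite mulr_ge0 ?expR_ge0 ?sqform_ge0.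
have ab : a < b by exact: lt_trans tb.
have [a' /(_ u)[C hC]] := Hgrowth.
pose B := expR (2 * (`|c| * b)) * (`|C| * expR (`|a'| * b)).
have lin (p q : R) : 0 < q <= b -> p * q <= `|p| * b.
  move=> /andP[q0 qb]; apply: (@le_trans _ _ (`|p| * q)).
    by rewrite ler_wpM2r ?ler_norm// ltW.
  by rewrite ler_wpM2l.
have gB x : a <= x <= b -> g x <= B.
  move=> /andP[ax xb]; have x0 : 0 < x by exact: lt_le_trans ax.
  apply: ler_pM; rewrite ?expR_ge0 ?sqform_ge0//.
    by rewrite ler_expR ler_pM2l// lin// x0.
  rewrite -metric_norm_sqr//; apply: (le_trans (hC x x0)).
  apply: (@le_trans _ _ (`|C| * expR (a' * x))).
    by rewrite ler_wpM2r ?expR_ge0 ?ler_norm.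
  by rewrite ler_wpM2l// ler_expR lin// x0.
have uscg p e : 0 < p -> g p < e ->
    exists2 d, 0 < d & forall x, 0 < x -> `|p - x| < d -> g x < e.
  move=> p0 gpe.
  have Fp : (F (p%:C)%C < e%:E)%E by rewrite sE//= lte_fin.
  have /nbhs_ballP[[d d'] /= d0 hd] := usc (p%:C)%C p0 e Fp.
  have dr : 0 < d by move: d0; rewrite ltcE /= => /andP[].
  exists d => // x x0 px; rewrite -lte_fin.
  have <- : F (x%:C)%C = (g x)%:E by rewrite sE.
  apply: hd; rewrite /ball /=; apply: normc_lt => //.
  rewrite -rmorphB sqabs_real /=.
  by rewrite -(real_normK (num_real (p - x))) ltr_pXn2r// nnegrE// ltW.
apply: (@submean_max_principle R g a b B ab g0 gB) => [e gae|e gbe|p r r0 ar rb|].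
- have [d d0 hd] := uscg a e a0 gae; exists d => // x /andP[ax xd].
  apply: hd; first exact: lt_le_trans ax.
  by rewrite ltr_norml; apply/andP; split; lra.
- have b0 : 0 < b by exact: lt_trans ab.
  (* The minimum with [b] keeps x > 0, where [g] is the squared norm of the section. *)
  have [d d0 hd] := uscg b e b0 gbe; exists (Num.min d b).
    by rewrite lt_min d0.
  have m1 : Num.min d b <= d by rewrite ge_min lexx.
  have m2 : Num.min d b <= b by rewrite ge_min lexx orbT.
  move=> x /andP[xd xb]; apply: hd; first by lra.
  by rewrite ltr_norml; apply/andP; split; lra.
- have p0 : 0 < p by lra.
  have Re_gt0 x : 0 < p + r * cos x.
    have := cos_geN1 x; rewrite -(ler_pM2l r0) mulrN1; lra.
  have mean_p := mean (p%:C)%C r r0.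
  have disc : [set w : Cplx R | ComplexField.Normc.normc (w - (p%:C)%C) <= r]
      `<=` @right_half_plane R.
    move=> [x y] /= nr; rewrite /right_half_plane /=.
    have nr2 : (x - p) ^+ 2 <= r ^+ 2.
      apply: (@le_trans _ _ (ComplexField.Normc.normc (x +i* y - (p%:C))%C ^+ 2)).
        by rewrite normc_sqabs /sqabs /= lerDl sqr_ge0.
      by rewrite lerXn2r ?nnegrE ?sqrtr_ge0// ltW.
    rewrite ltNge; apply/negP => x0.
    have : p ^+ 2 <= (x - p) ^+ 2 by rewrite -[(x - p) ^+ 2]sqrrN lerXn2r ?nnegrE; lra.
    move=> pr; have : p ^+ 2 <= r ^+ 2 by exact: le_trans nr2.
    by rewrite ler_pXn2r// ?nnegrE; lra.
  have FE x : F ((p%:C)%C + (r%:C)%C * (cos x +i* sin x)%C) = (g (p + r * cos x))%:E.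
    have reE : complex.Re ((p%:C)%C + (r%:C)%C * (cos x +i* sin x)%C) = p + r * cos x.
      by rewrite /= mul0r subr0.
    by rewrite sE reE.
  have <- : F (p%:C)%C = (g p)%:E by rewrite sE.
  apply: (le_trans (mean_p disc)).
  by under eq_integral do rewrite -/(F _) FE.
by rewrite at_.
Qed.

(** A suitable twist makes the chord of the logarithm horizontal, and the maximum principle then
    says that the graph lies below it. *)
Lemma negative_curvature_log_convex : log_convex_family (sqform H).
Proof.
split=> [t _|t u _|u a t b u0 a0 at_ tb]; [exact: sqform_quadratic|exact: sqform_gt0|].
have ab : a < b by exact: lt_trans tb.
pose k := (ln (sqform H b u) - ln (sqform H a u)) / (b - a).
(* With this c the twisted function takes equal values at a and b. *)
pose c := - k / 2.
have := exp_twist_max_principle u c a0 at_ tb.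
have fE x : expR (2 * (c * x)) * sqform H x u = expR (ln (sqform H x u) - k * x).
  rewrite expRD lnK ?posrE ?sqform_gt0// mulrC; congr (_ * expR _).
  by rewrite /c; field.
have kE : k * (b - a) = ln (sqform H b u) - ln (sqform H a u).
  by rewrite divfK// gt_eqF// subr_gt0.
rewrite !fE.
have -> : ln (sqform H b u) - k * b = ln (sqform H a u) - k * a by lra.
rewrite maxxx ler_expR => le_t.
have {}le_t : (b - a) * ln (sqform H t u) <=
    (b - a) * (ln (sqform H a u) + k * (t - a)).
  by rewrite ler_pM2l ?subr_gt0//; lra.
apply: (le_trans le_t); rewrite le_eqVlt; apply/orP; left; apply/eqP.
have -> : (b - a) * (ln (sqform H a u) + k * (t - a)) =
  (b - a) * ln (sqform H a u) + (k * (b - a)) * (t - a) by ring.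
by rewrite kE; ring.
Qed.

Lemma moderate_growth_le : exists a, forall u, growth_le (sqform H) u a.
Proof.
have [a ha] := Hgrowth; exists a => u; have [C hC] := ha u.
by exists C => t t1; rewrite -metric_norm_sqr ?hC//; exact: lt_le_trans t1.
Qed.

End NegativeCurvature.

(** * Lower bounds and exact growth rates for log-convex families *)

Section FamilyBounds.
Variables (R : realType) (V : vectType R[i]) (h : R -> V -> R).
Hypothesis hF : log_convex_family h.
Implicit Types u w : V.

(** Equivalence of two norms in finite dimension, in logarithmic form. *)
Lemma ln_comparison s t : 0 < s -> 0 < t ->
  exists2 L, 0 <= L & forall u, u != 0 -> ln (h s u) - ln (h t u) <= L.
Proof.
move=> s0 t0; have [C C0 hC] := quadratic_le_coord_norm (family_quadratic hF s0).
have [c c0 hc] := definite_ge_coord_norm (family_quadratic hF t0)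
  (fun u => family_gt0 hF t0 (u := u)).
exists `|ln C - ln c| => // w w0; apply: le_trans (ler_norm _).
have q0 := coord_norm_gt0 w0.
have : ln (h s w) <= ln (C * coord_norm w).
  by rewrite ler_ln ?posrE ?mulr_gt0 ?(family_gt0 hF).
have : ln (c * coord_norm w) <= ln (h t w).
  by rewrite ler_ln ?posrE ?mulr_gt0 ?(family_gt0 hF).
by rewrite !lnM ?posrE//; lra.
Qed.

(* Convexity through the points 1/2 and 1 bounds the norms from below for large
   t, through 1 and 2 for small t. *)
Lemma family_ge_coord_norm :
  exists c k, [/\ 0 < c, 0 <= k & forall t u, 0 < t ->
    c * expR (- (k * t)) * coord_norm u <= h t u].
Proof.
have half0 : (0 : R) < 1 / 2 by rewrite divr_gt0.
have two0 : (0 : R) < 2 by [].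
have [L1 L10 hL1] := ln_comparison half0 ltr01.
have [L2 L20 hL2] := ln_comparison two0 ltr01.
have [c c0 hc] := definite_ge_coord_norm (family_quadratic hF ltr01)
  (fun u => family_gt0 hF ltr01 (u := u)).
(* On [1/2, 1] the slope of [ln (h t u)] is at least -2 L1, and hence beyond 1 too. Times below 1
   cost at most L2. *)
exists (c * expR (- L2)), (2 * L1); split; rewrite ?mulr_gt0 ?expR_gt0 ?mulr_ge0//.
move=> t u t0; have [->|u0] := eqVneq u 0.
  rewrite (quadratic0 (quadratic_coord_norm V)) mulr0.
  by rewrite (quadratic0 (family_quadratic hF t0)).
have q0 := coord_norm_gt0 u0.
suff le_phi : ln (h 1 u) - L2 - 2 * L1 * t <= ln (h t u).
  move: le_phi; rewrite -ler_expR [X in _ <= X -> _]lnK ?posrE ?(family_gt0 hF)//.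
  apply: le_trans; rewrite -addrA expRD lnK ?posrE ?(family_gt0 hF)//.
  have -> : c * expR (- L2) * expR (- (2 * L1 * t)) * coord_norm u =
      c * coord_norm u * expR (- L2 - 2 * L1 * t) by rewrite expRD; ring.
  by rewrite ler_wpM2r ?expR_ge0.
have := hL1 _ u0; have := hL2 _ u0 => a2 a1.
have Lt : 0 <= L1 * t by rewrite mulr_ge0// ltW.
case: (ltgtP t 1) => [t1|t1|->]; last by lra.
- have := family_convex hF u0 t0 t1 (ltr1n R 2).
  have : (1 - t) * (ln (h 2 u) - ln (h 1 u)) <= (1 - t) * L2.
    by rewrite ler_wpM2l// subr_ge0 ltW.
  have : 0 <= t * L2 by rewrite mulr_ge0// ltW.
  lra.
- have h1 : (1 / 2 : R) < 1 by lra.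
  have := family_convex hF u0 half0 h1 t1.
  have : (t - 1) * (ln (h (1 / 2) u) - ln (h 1 u)) <= (t - 1) * L1.
    by rewrite ler_wpM2l// subr_ge0 ltW.
  lra.
Qed.

Lemma growth_leS u b b' : b <= b' -> growth_le h u b -> growth_le h u b'.
Proof.
move=> bb' [C hC]; exists `|C| => t t1.
have t0 : 0 < t by exact: lt_le_trans t1.
apply: (le_trans (hC _ t1)); apply: (@le_trans _ _ (`|C| * expR (b * t))).
  by rewrite ler_wpM2r ?expR_ge0 ?ler_norm.
by rewrite ler_wpM2l// ler_expR ler_wpM2r// ltW.
Qed.

Lemma growth_le0 b : growth_le h 0 b.
Proof.
exists 0 => t t1; rewrite mul0r.
by rewrite (quadratic0 (family_quadratic hF _))//; exact: lt_le_trans t1.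
Qed.

Lemma growth_leD u w b : growth_le h u b -> growth_le h w b -> growth_le h (u + w) b.
Proof.
move=> [C hC] [D hD]; exists (2 * (C + D)) => t t1.
have t0 : 0 < t by exact: lt_le_trans t1.
apply: (le_trans (quadraticD (family_quadratic hF t0) _ _)).
by have := hC _ t1; have := hD _ t1; lra.
Qed.

Lemma growth_leZ k u b : growth_le h u b -> growth_le h (k *: u) b.
Proof.
move=> [C hC]; exists (sqabs k * C) => t t1.
have t0 : 0 < t by exact: lt_le_trans t1.
by rewrite (quadraticZ (family_quadratic hF t0)) -mulrA ler_wpM2l ?sqabs_ge0 ?hC.
Qed.

Lemma growth_le_lim u b : (forall b', b < b' -> growth_le h u b') -> growth_le h u b.
Proof.
have [-> _|u0 hb] := eqVneq u 0; first exact: growth_le0.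
have b1 : b < b + 1 by rewrite ltrDl.
have [s us smin] := growth_rate_inf hF u0 (hb (b + 1) b1).
apply: growth_leS us; apply/ler_addgt0Pr => e e0.
by apply: smin; apply: hb; rewrite ltrDl.
Qed.

(** Chords over [1, 2] have slopes bounded below uniformly in [u], so the filtration is trivial far
    to the left. *)
Lemma growth_le_lower_bound : exists L, forall u b, u != 0 -> growth_le h u b -> L <= b.
Proof.
have two0 : (0 : R) < 2 by [].
have [L _ hL] := ln_comparison ltr01 two0.
exists (- L) => u b u0 /(growth_leP hF _ u0)/(_ 1 2 ltr01 (ltr1n R 2)).
by have := hL _ u0; lra.
Qed.

(** All chords have slope at most [s]. By minimality some chord has slope above s - e/2, and
    convexity passes this lower bound to all later times. *)
Lemma growth_rate_cvg u s : u != 0 -> growth_le h u s ->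
  (forall d, growth_le h u d -> s <= d) ->
  t^-1 * ln (h t u) @[t --> +oo] --> s.
Proof.
move=> u0 /(growth_leP hF _ u0) us smin.
apply/(@cvgrPdist_le _ _ _ (pinfty_nbhs R)) => e e0.
have e2 : 0 < e / 2 by rewrite divr_gt0.
have [p [q [p0 pq slope]]] : exists p q, [/\ 0 < p, p < q &
    ln (h p u) + (s - e / 2) * (q - p) < ln (h q u)].
  apply: contrapT => nslope.
  have : growth_le h u (s - e / 2).
    apply/(growth_leP hF _ u0) => p q p0 pq; rewrite leNgt; apply/negP => lt_q.
    by apply: nslope; exists p, q.
  by move=> /smin; lra.
(* The constants of the upper and lower affine bounds, at most (e/2) t once t exceeds A / (e/2). *)
pose A := `|ln (h 1 u) - s| + `|ln (h p u) - (s - e / 2) * p|.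
exists (Num.max 1 (Num.max q (A / (e / 2)))); split; first exact: num_real.
move=> t; rewrite !gt_max => /andP[t1 /andP[qt At]].
have t0 : 0 < t by exact: lt_trans t1.
have up := us 1 t ltr01 t1.
have low : ln (h p u) + (s - e / 2) * (t - p) <= ln (h t u).
  have cv := family_convex hF u0 p0 pq qt.
  have qp : 0 < q - p by lra.
  rewrite -(ler_pM2l qp).
  have : (t - p) * (ln (h p u) + (s - e / 2) * (q - p)) <= (t - p) * ln (h q u).
    by rewrite ler_wpM2l ?ltW//; lra.
  lra.
move: At; rewrite ltr_pdivrMr// => At.
have := ler_norm (ln (h 1 u) - s); have := ler_norm (- (ln (h p u) - (s - e / 2) * p)).
rewrite normrN => n1 n2.
have := normr_ge0 (ln (h 1 u) - s); have := normr_ge0 (ln (h p u) - (s - e / 2) * p).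
rewrite /A in At => n3 n4.
have -> : s - t^-1 * ln (h t u) = (s * t - ln (h t u)) / t by field; rewrite gt_eqF.
rewrite normf_div (gtr0_norm t0) ler_pdivrMr// ler_norml.
by apply/andP; split; lra.
Qed.

End FamilyBounds.

(** * Filtration and jumping numbers *)

Section Filtrations.
Variables (R : realType) (V : vectType R[i]) (H : R -> {dot V for Num.conj}).
Hypotheses (hF : log_convex_family (sqform H))
  (hG : exists a, forall u, growth_le (sqform H) u a).

Lemma growth_rateE u s : u != 0 -> growth_le (sqform H) u s ->
  (forall d, growth_le (sqform H) u d -> s <= d) -> growth_rate H u = s%:E.
Proof.
move=> u0 us smin; rewrite /growth_rate (negbTE u0).
apply: cvg_lim => //; apply: cvg_EFin; first exact: nearW.
apply: cvg_trans (growth_rate_cvg hF u0 us smin).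
apply: near_eq_cvg; exists 0; split; first exact: num_real.
by move=> t t0 /=; rewrite metric_norm_sqr.
Qed.

Lemma filtrationE (b : R) : filtration H b%:E = [set u | growth_le (sqform H) u b].
Proof.
rewrite /filtration /=; apply/seteqP; split=> u /=.
  have [-> _|u0] := eqVneq u 0; first exact: growth_le0.
  have [a /(_ u) ua] := hG; have [s us smin] := growth_rate_inf hF u0 ua.
  by rewrite (growth_rateE u0 us smin) lee_fin => sb; exact: growth_leS us.
move=> ub; have [->|u0] := eqVneq u 0; first by rewrite /growth_rate eqxx leNye.
have [s us smin] := growth_rate_inf hF u0 ub.
by rewrite (growth_rateE u0 us smin) lee_fin smin.
Qed.

(** A subspace contained in [S] of maximal dimension is all of [S]: adjoining a vector of [S] cannot
    raise the dimension. *)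
Lemma vspace_of_submodule (S : set V) : S 0 ->
  (forall u w, S u -> S w -> S (u + w)) -> (forall k u, S u -> S (k *: u)) ->
  exists W : {vspace V}, [set u | u \in W] = S.
Proof.
move=> S0 SD SZ.
pose P n := `[< exists2 W : {vspace V}, (forall u, u \in W -> S u) & \dim W = n >].
have exP : exists n, P n.
  exists 0%N; apply/asboolP; exists 0%VS; rewrite ?dimv0// => u.
  by rewrite memv0 => /eqP ->.
have boundP n : P n -> (n <= \dim {:V})%N.
  by move=> /asboolP[W _ <-]; exact/dimvS/subvf.
case: (ex_maxnP exP boundP) => n /asboolP[W WS dimW] maxn.
exists W; apply/seteqP; split=> u /=; first exact: WS.
move=> Su; have : P (\dim (W + <[u]>)%VS).
  apply/asboolP; exists (W + <[u]>)%VS => // _ /memv_addP[w wW [_ /vlineP[k ->] ->]].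
  by apply: SD; [exact: WS|exact: SZ].
move=> /maxn; rewrite -dimW => dimle.
have /eqP WE : (W == W + <[u]>)%VS by rewrite eqEdim addvSl.
by rewrite WE memvE addvSr.
Qed.

(** The filtration is closed under linear combinations, so the choice in [filtration_space] does not
    fall back on its default. *)
Lemma mem_filtration_space b u :
  u \in filtration_space H b%:E <-> growth_le (sqform H) u b.
Proof.
have [W WE] : exists W : {vspace V}, [set u | u \in W] = filtration H b%:E.
  rewrite filtrationE; apply: vspace_of_submodule => /=.
  - exact: growth_le0.
  - by move=> x y; exact: growth_leD.
  - by move=> k x; exact: growth_leZ.
have : [set u | u \in filtration_space H b%:E] = filtration H b%:E.
  by rewrite /filtration_space; case: xgetP => [? -> //|/(_ W)].
by rewrite filtrationE => /seteqP[h1 h2]; split; [exact: h1|exact: h2].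
Qed.

Lemma filtration_spaceS b b' : b <= b' ->
  (filtration_space H b%:E <= filtration_space H b'%:E)%VS.
Proof.
move=> bb'; apply/subvP => u /mem_filtration_space ub.
by apply/mem_filtration_space; exact: growth_leS ub.
Qed.

(** Take b > a with V_b of least dimension: the spaces are constant on (a, b], and [growth_le_lim]
    identifies their intersection with V_a. *)
Lemma filtration_space_right_continuous a :
  exists2 b, a < b & filtration_space H b%:E = filtration_space H a%:E.
Proof.
pose P n := `[< exists2 b, a < b & \dim (filtration_space H b%:E) = n >].
have exP : exists n, P n.
  by eexists; apply/asboolP; exists (a + 1); rewrite ?ltrDl.
case: (ex_minnP exP) => n /asboolP[b ab dimb] minn.
exists b => //; apply/eqP; rewrite eqEsubv (filtration_spaceS (ltW ab)) andbT.
apply/subvP => u ub; apply/mem_filtration_space; apply: (growth_le_lim hF) => b' ab'.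
apply/mem_filtration_space; have [bb'|b'b] := leP b b'.
  exact: subvP (filtration_spaceS bb') _ ub.
suff /eqP -> : filtration_space H b'%:E == filtration_space H b%:E by [].
rewrite eqEdim (filtration_spaceS (ltW b'b)) dimb; apply: minn.
by apply/asboolP; exists b'.
Qed.

(** The minimum exists: moderate growth makes the set nonempty, [growth_le_lower_bound] bounds it
    below, and right continuity puts the infimum in it. *)
Lemma jumping_numberP j : (0 < j <= \dim {:V})%N ->
  exists a, [/\ jumping_number H j = a%:E,
    (j <= \dim (filtration_space H a%:E))%N &
    forall b, (j <= \dim (filtration_space H b%:E))%N -> a <= b].
Proof.
case: j => // j /= jn.
pose S := [set a : R | (j.+1 <= \dim (filtration_space H a%:E))%N].
have [a0 ha0] := hG.
have full : filtration_space H a0%:E = fullv.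
  apply/eqP; rewrite eqEsubv subvf /=; apply/subvP => u _.
  exact/mem_filtration_space.
have S0 : S a0 by rewrite /S /= full.
have [L hL] := growth_le_lower_bound hF.
have lbS : lbound S L.
  move=> b /= Sb; have nz : filtration_space H b%:E != 0%VS.
    by apply: contraTneq Sb => ->; rewrite dimv0.
  apply: (hL (vpick (filtration_space H b%:E))); first by rewrite vpick0.
  by apply/mem_filtration_space; exact: memv_pick.
have infS : lbound S (inf S).
  by move=> b Sb; apply: ge_inf => //; exists L.
have SinfS : S (inf S).
  have [b ab fE] := filtration_space_right_continuous (inf S).
  have [c Sc cb] := inf_lt (ex_intro _ a0 S0) ab.
  rewrite /S /= -fE; apply: (leq_trans Sc); apply/dimvS/filtration_spaceS.
  exact: ltW.
have : (S (xget 0 [set a | S a /\ lbound S a])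
    /\ lbound S (xget 0 [set a | S a /\ lbound S a])).
  by case: xgetP => [? -> //|/(_ (inf S))]; case.
by move=> [Sx lbx]; exists (xget 0 [set a | S a /\ lbound S a]).
Qed.

(** Below the next jump the dimension is at most [j], while that of V_{alpha_j} is at least [j], so
    the nested spaces agree. *)
Lemma filtration_gap j (alpha : R) : (j < \dim {:V})%N ->
  (jumping_number H j <= alpha%:E)%E -> (alpha%:E < jumping_number H j.+1)%E ->
  exists g, [/\ jumping_number H j.+1 = g%:E, alpha < g &
    forall u b, b < g -> growth_le (sqform H) u b ->
      filtration H (jumping_number H j) u].
Proof.
move=> jn lo hi; have [g [gE _ gmin]] := jumping_numberP (j := j.+1) jn.
exists g; split=> //; first by move: hi; rewrite gE lte_fin.
(* The maximum with [alpha] places [c] at or above the jump alpha_j, and still below [g]. *)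
move=> u b bg ub; pose c := Num.max alpha b.
have cg : c < g by rewrite gt_max bg andbT; move: hi; rewrite gE lte_fin.
have uc : u \in filtration_space H c%:E.
  by apply/mem_filtration_space; apply: growth_leS ub; rewrite le_max lexx orbT.
have dimc : (\dim (filtration_space H c%:E) <= j)%N.
  by rewrite leqNgt; apply/negP => /gmin; rewrite leNgt cg.
case: j jn lo {hi gE gmin} dimc => [|j] jn lo dimc.
  rewrite /filtration /=; move: dimc; rewrite leqn0 dimv_eq0 => /eqP c0.
  by move: uc; rewrite c0 memv0 => /eqP.
have [a [aE dima _]] := jumping_numberP (j := j.+1) (ltnW jn).
have ac : a <= c by rewrite le_max -lee_fin -aE lo.
rewrite aE filtrationE /=; apply/mem_filtration_space.
suff /eqP -> : filtration_space H a%:E == filtration_space H c%:E by [].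
by rewrite eqEdim filtration_spaceS//= (leq_trans dimc).
Qed.

Lemma filtration_growth j (alpha : R) u : (j < \dim {:V})%N ->
  (jumping_number H j <= alpha%:E)%E ->
  filtration H (jumping_number H j) u -> growth_le (sqform H) u alpha.
Proof.
case: j => [|j] jn lo; first by rewrite /filtration /= => ->; exact: growth_le0.
have [a [aE _ _]] := jumping_numberP (j := j.+1) (ltnW jn).
by rewrite aE filtrationE /= => ua; apply: growth_leS ua; rewrite -lee_fin -aE.
Qed.

End Filtrations.

(** * Dual norm *)

Section DualNorm.
Variables (R : realType) (V : vectType R[i]) (H : R -> {dot V for Num.conj}).
Implicit Types (u : V) (v : 'Hom(V, (R[i])^o)).

Lemma metric_norm_ge0 t u : 0 <= metric_norm H t u.
Proof.
rewrite /metric_norm /form_norm; case: ifP => _; first exact: sqrtr_ge0.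
by case: ifP => _ //; exact: expR_ge0.
Qed.

Lemma dual_norm_ge0 t v : (0 <= dual_norm H t v)%E.
Proof.
apply: ereal_sup_ubound; exists 0; last by rewrite linear0 ComplexField.Normc.normc0.
rewrite /= /metric_norm /form_norm eqxx; case: ifP => // _.
by rewrite linear0r sqrtr0.
Qed.

Lemma dual_norm_sqr_ge0 t v : (0 <= dual_norm H t v ^+ 2)%E.
Proof. by rewrite expe_ge0// dual_norm_ge0. Qed.

Lemma dual_norm_sqr_le t v M : 0 <= M ->
  (forall u, sqabs (v u) <= M * metric_norm H t u ^+ 2) ->
  (dual_norm H t v ^+ 2 <= M%:E)%E.
Proof.
move=> M0 hM; have : (dual_norm H t v <= (Num.sqrt M)%:E)%E.
  apply: ub_ereal_sup => _ [u /= u1 <-]; rewrite lee_fin.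
  rewrite -(@ler_pXn2r _ 2)// ?nnegrE ?sqrtr_ge0//; last first.
    by case: (v u) => x y; exact: sqrtr_ge0.
  rewrite normc_sqabs sqr_sqrtr// (le_trans (hM u))// ler_piMr//.
  by rewrite expr_le1// metric_norm_ge0.
have := dual_norm_ge0 t v; case: (dual_norm H t v) => [r||]//.
move=> r0 rM; rewrite -EFin_expe; move: r0 rM; rewrite !lee_fin => r0 rM.
by rewrite -(sqr_sqrtr M0) ler_pXn2r// nnegrE sqrtr_ge0.
Qed.

(** The test vector is [u] scaled to norm 1 at time [t]. *)
Lemma dual_norm_sqr_ge t v u : 0 < t -> u != 0 ->
  ((sqabs (v u) / sqform H t u)%:E <= dual_norm H t v ^+ 2)%E.
Proof.
move=> t0 u0; have h0 := sqform_gt0 H t u0.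
pose k := (Num.sqrt (sqform H t u))^-1.
have : ((ComplexField.Normc.normc (v (k%:C%C *: u)))%:E <= dual_norm H t v)%E.
  apply: ereal_sup_ubound; exists (k%:C%C *: u) => //=.
  rewrite -(@expr_le1 _ 2)// ?metric_norm_sqr//; last first.
    by rewrite /metric_norm t0 sqrtr_ge0.
  rewrite (quadraticZ (sqform_quadratic H t)) sqabs_real exprVn sqr_sqrtr ?(ltW h0)//.
  by rewrite mulVf ?gt_eqF.
have -> : sqabs (v u) / sqform H t u = ComplexField.Normc.normc (v (k%:C%C *: u)) ^+ 2.
  rewrite normc_sqabs linearZ sqabsM sqabs_real exprVn sqr_sqrtr ?(ltW h0)//.
  exact: mulrC.
have : 0 <= ComplexField.Normc.normc (v (k%:C%C *: u)).
  by case: (v _) => x y; exact: sqrtr_ge0.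
move: (ComplexField.Normc.normc _) => n n0.
case: (dual_norm H t v) => [r nr|_|].
- rewrite -EFin_expe lee_fin; move: nr; rewrite lee_fin => nr.
  by rewrite lerXn2r// nnegrE (le_trans n0).
- by rewrite expe2 mulyy leey.
- by rewrite leeNy_eq.
Qed.

Hypotheses (hF : log_convex_family (sqform H)) (Hext : extends_to_zero H).

(** Dual to [family_ge_coord_norm]. It controls the integrand of (b) on bounded intervals, including
    t = 0, where the lower bound passes to the limit norm. *)
Lemma dual_norm_sqr_bound v : exists2 K, 0 < K &
  exists2 k, 0 <= k & forall t, 0 <= t ->
    (dual_norm H t v ^+ 2 <= (K * expR (k * t))%:E)%E.
Proof.
have [C C0 hC] := quadratic_le_coord_norm (quadratic_functional v).
have [c [k [c0 k0 low]]] := family_ge_coord_norm hF.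
(* The factor e^k serves t = 0, where the lower bound is used for 0 < s < 1 only. For t > 0 it is
   discarded as being at least 1. *)
pose K := C / (c * expR (- k)).
have K0 : 0 < K by rewrite divr_gt0// mulr_gt0// expR_gt0.
have q0 u := quadratic_ge0 (quadratic_coord_norm V) u.
exists K => //; exists k => // t; rewrite le_eqVlt => /orP[/eqP <-|t0].
  rewrite mulr0 expR0 mulr1; apply: dual_norm_sqr_le => [|u]; first exact: ltW.
  rewrite /metric_norm ltxx; case: ifPn => [/eqP ->|u0].
    by rewrite linear0 sqabs0 expr0n mulr0.
  have qu0 := coord_norm_gt0 u0.
  have lim_ge : ln (c * expR (- k) * coord_norm u) / 2 <=
      lim (ln (form_norm H s u) @[s --> 0^'+]).
    apply: limr_ge; first exact: Hext.
    near=> s; have s0 : 0 < s by near: s; exact: nbhs_right_gt.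
    have s1 : s < 1 by near: s; exact: nbhs_right_lt.
    have hs := sqform_gt0 H s u0.
    have -> : ln (form_norm H s u) = ln (sqform H s u) / 2.
      have -> : sqform H s u = form_norm H s u ^+ 2 by rewrite sqr_sqrtr ?sqform_ge0.
      by rewrite lnXn ?sqrtr_gt0// -[ln _ *+ 2]mulr_natr mulfK.
    rewrite ler_pM2r ?invr_gt0// ler_ln ?posrE ?mulr_gt0 ?expR_gt0//.
    apply: le_trans (low s u s0); rewrite ler_wpM2r// (ler_wpM2l (ltW c0))// ler_expR.
    by rewrite lerN2 ler_piMr// ltW.
  have := lim_ge; rewrite -ler_expR => le_e.
  have : c * expR (- k) * coord_norm u <=
      expR (lim (ln (form_norm H s u) @[s --> 0^'+])) ^+ 2.
    rewrite -[leLHS]lnK ?posrE ?mulr_gt0 ?expR_gt0//.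
    have -> : ln (c * expR (- k) * coord_norm u) =
        ln (c * expR (- k) * coord_norm u) / 2 * 2 by rewrite divfK.
    by rewrite [_ / 2 * 2]mulrC expRM_natl lerXn2r ?nnegrE ?expR_ge0.
  move=> le_c; apply: (le_trans (hC u)); rewrite /K mulrAC.
  rewrite ler_pdivlMr ?mulr_gt0 ?expR_gt0// -mulrA ler_pM2l// mulrC.
  exact: le_c.
apply: dual_norm_sqr_le => [|u].
  by rewrite mulr_ge0 ?ltW// ?expR_gt0.
rewrite metric_norm_sqr//; apply: (le_trans (hC u)).
have := low t u t0; rewrite expRN mulrAC ler_pdivrMr ?expR_gt0// => le_h.
have -> : K * expR (k * t) * sqform H t u =
    C / c * expR k * (sqform H t u * expR (k * t)).
  rewrite /K expRN; field; rewrite ?gt_eqF ?expR_gt0//.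
apply: (@le_trans _ _ (C / c * expR k * (c * coord_norm u))).
  have -> : C / c * expR k * (c * coord_norm u) = expR k * (C * coord_norm u).
    by field; rewrite gt_eqF.
  rewrite ler_peMl ?mulr_ge0 ?(ltW C0)//.
  by rewrite -(expR0 R) ler_expR.
rewrite ler_wpM2l// mulr_ge0 ?expR_ge0// divr_ge0// ltW//.
Unshelve. all: by end_near. Qed.

End DualNorm.

(** * From the size of the dual norm to the integral and the limsup *)

Section Equivalences.
Variables (R : realType) (V : vectType R[i]) (H : R -> {dot V for Num.conj}).
Variables (v : 'Hom(V, (R[i])^o)) (alpha g : R).
Hypotheses (hF : log_convex_family (sqform H)) (ag : alpha < g).

(** Comparison with the exponential density of rate [e], which has total mass 1. *)
Lemma exponential_integral_lty (C e : R) : 0 < C -> 0 < e ->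
  (\int[lebesgue_measure]_(t in `[0%R, +oo[) (C * expR (- e * t))%:E < +oo)%E.
Proof.
move=> C0 e0; have Ce : (0 <= (C / e)%:E)%E by rewrite lee_fin divr_ge0 ?ltW.
apply: (@le_lt_trans _ _ (\int[lebesgue_measure]_t
    ((C / e)%:E * (exponential_pdf e t)%:E))%E).
  rewrite integral_mkcond; apply: ge0_le_integral_nonmeasurable => t _.
    apply: erestrict_ge0 => x _; rewrite lee_fin mulr_ge0 ?expR_ge0//; exact: ltW.
  rewrite patchE; case: ifPn => [|_].
    rewrite inE /= in_itv /= andbT => t0.
    by rewrite exponential_pdfE// -EFinM lee_fin mulrA divfK ?gt_eqF.
  by rewrite mule_ge0// lee_fin exponential_pdf_ge0// ltW.
rewrite ge0_integralZl//.
- by rewrite integral_exponential_pdf// mule1 ltry.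
- apply/measurable_realfun.measurable_EFinP; exact: measurable_exponential_pdf.
- by move=> t _; rewrite lee_fin exponential_pdf_ge0// ltW.
Qed.

Lemma fast_decay_integral : extends_to_zero H ->
  (forall b, b < g -> exists2 T0, 0 < T0 & forall t, T0 <= t ->
     (dual_norm H t v ^+ 2 <= (expR (- b * t))%:E)%E) ->
  (\int[lebesgue_measure]_(t in `[0%R, +oo[)
     (dual_norm H t v ^+ 2 * (expR (t * alpha))%:E) < +oo)%E.
Proof.
move=> Hext decay; pose b := (alpha + g) / 2; pose e := b - alpha.
have bg : b < g by exact: (midf_lt ag).2.
have e0 : 0 < e by rewrite subr_gt0; exact: (midf_lt ag).1.
have [T0 T00 hT] := decay b bg.
have [K K0 [k k0 hK]] := dual_norm_sqr_bound hF Hext v.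
(* The 1 serves times beyond [T0]. The other term dominates the crude bound on [0, T0] after
   multiplication by e^{-et}. *)
pose C := 1 + K * expR ((k + `|alpha| + e) * T0).
have KE0 : 0 <= K * expR ((k + `|alpha| + e) * T0).
  by rewrite mulr_ge0 ?expR_ge0// ltW.
have C0 : 0 < C by rewrite ltr_pwDl.
apply: le_lt_trans (exponential_integral_lty C0 e0).
apply: ge0_le_integral_nonmeasurable => t /=; rewrite in_itv /= andbT => t0.
  by rewrite mule_ge0 ?dual_norm_sqr_ge0// lee_fin expR_ge0.
have [Tt|tT] := leP T0 t.
  apply: (@le_trans _ _ ((expR (- b * t))%:E * (expR (t * alpha))%:E)%E).
    by rewrite lee_wpmul2r ?lee_fin ?expR_ge0// hT.
  rewrite -EFinM lee_fin -expRD.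
  have -> : - b * t + t * alpha = - e * t by rewrite /e; ring.
  by rewrite ler_peMl ?expR_ge0// /C lerDl.
apply: (@le_trans _ _ ((K * expR (k * t))%:E * (expR (t * alpha))%:E)%E).
  by rewrite lee_wpmul2r ?lee_fin ?expR_ge0// hK.
rewrite -EFinM lee_fin -mulrA -expRD.
apply: (@le_trans _ _ (K * expR ((k + `|alpha| + e) * T0) * expR (- e * t))).
  rewrite -mulrA -expRD ler_wpM2l ?(ltW K0)// ler_expR.
  have p1 : k * t <= k * T0 by rewrite ler_wpM2l// ltW.
  have p2 : t * alpha <= t * `|alpha| by rewrite ler_wpM2l// ler_norm.
  have p3 : t * `|alpha| <= T0 * `|alpha| by rewrite ler_wpM2r// ltW.
  have p4 : e * t <= e * T0 by rewrite ler_wpM2l ?(ltW e0) ?(ltW tT).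
  lra.
by rewrite ler_wpM2r ?expR_ge0// /C lerDr.
Qed.

Lemma fast_decay_limsup :
  (forall b, b < g -> exists2 T0, 0 < T0 & forall t, T0 <= t ->
     (dual_norm H t v ^+ 2 <= (expR (- b * t))%:E)%E) ->
  (limf_esup (fun t : R => (t^-1)%:E * lne (dual_norm H t v ^+ 2)) +oo%R <= - g%:E)%E.
Proof.
move=> decay; apply/lee_addgt0Pr => e e0.
have [|T0 T00 hT] := decay (g - e); first by rewrite gtrBl.
apply: (@le_trans _ _ (ereal_sup ((fun t : R =>
    ((t^-1)%:E * lne (dual_norm H t v ^+ 2))%E) @` [set t | T0 < t]))).
  apply: ereal_inf_lbound; exists [set t | T0 < t] => //.
  exact: (nbhs_pinfty_gt (num_real T0)).
apply: ub_ereal_sup => _ [t Tt <-].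
have t0 : 0 < t by exact: lt_trans Tt.
rewrite -[(- g%:E)%E]/((- g)%:E) -EFinD.
have : (lne (dual_norm H t v ^+ 2) <= (- (g - e) * t)%:E)%E.
  rewrite -[X in (_ <= X%:E)%E]expRK -lne_EFin ?expR_gt0// lee_lne ?(hT _ (ltW Tt))//.
  - by rewrite in_itv /= leey dual_norm_sqr_ge0.
  - by rewrite in_itv /= leey lee_fin expR_ge0.
have ti : (0 <= (t^-1)%:E)%E by rewrite lee_fin invr_ge0 ltW.
move=> /(lee_wpmul2l ti) /le_trans; apply.
by rewrite -EFinM lee_fin mulrCA mulVf ?gt_eqF// mulr1 opprB addrC.
Qed.

Lemma slow_dual_lower_bound u : v u != 0 -> growth_le (sqform H) u alpha ->
  exists2 k, 0 < k & forall t, 1 <= t ->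
    ((k * expR (- alpha * t))%:E <= dual_norm H t v ^+ 2)%E.
Proof.
move=> vu [C hC]; have u0 : u != 0 by apply: contraNneq vu => ->; rewrite linear0.
have C0 : 0 < C.
  rewrite -(pmulr_lgt0 _ (expR_gt0 (alpha * 1))).
  by apply: lt_le_trans (hC 1 _) => //; exact: sqform_gt0.
have vu0 : 0 < sqabs (v u) by rewrite sqabs_gt0.
exists (sqabs (v u) / C); first by rewrite divr_gt0.
move=> t t1; have t0 : 0 < t by exact: lt_le_trans t1.
apply: (le_trans _ (dual_norm_sqr_ge H v t0 u0)); rewrite lee_fin.
rewrite -mulrA ler_pM2l// mulNr expRN -invfM lef_pV2 ?posrE ?sqform_gt0 ?hC//.
by rewrite mulr_gt0// expR_gt0.
Qed.

(** From time 1 on the integrand is at least [k]. *)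
Lemma slow_dual_integral k : 0 < k ->
  (forall t, 1 <= t -> ((k * expR (- alpha * t))%:E <= dual_norm H t v ^+ 2)%E) ->
  (\int[lebesgue_measure]_(t in `[0%R, +oo[)
     (dual_norm H t v ^+ 2 * (expR (t * alpha))%:E) = +oo)%E.
Proof.
move=> k0 low; apply/eqP; rewrite -leye_eq.
have <- : (\int[lebesgue_measure]_(t in `[0%R, +oo[)
    (k%:E * (\1_[set` `[1%R, +oo[] (t : R))%:E) = +oo)%E.
  have kE : (0 <= k%:E)%E by rewrite lee_fin ltW.
  rewrite ge0_integralZl//; last first.
    apply/measurable_realfun.measurable_EFinP.
    by apply: measurable_realfun.measurable_indic; exact: measurable_itv.
  rewrite integral_indic//.
  have -> : [set` `[1%R, +oo[] `&` [set` `[0%R, +oo[] = [set` `[(1 : R), +oo[].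
    apply/seteqP; split=> t /=; first by case.
    by rewrite !in_itv /= !andbT => t1; split=> //; exact: le_trans t1.
  by rewrite [X in (_ * X)%E]lebesgue_measure_itv /= ltry /= gt0_muley.
apply: ge0_le_integral_nonmeasurable => t /=; rewrite in_itv /= andbT => t0.
  by rewrite mule_ge0// lee_fin ltW.
rewrite indicE; have [t1|t1] := pselect ([set` `[(1 : R), +oo[] t); last first.
  by rewrite memNset// mule0 mule_ge0 ?dual_norm_sqr_ge0// lee_fin expR_ge0.
rewrite mem_set// mule1.
move: t1; rewrite /= in_itv /= andbT => /low le_k.
apply: (@le_trans _ _ ((k * expR (- alpha * t))%:E * (expR (t * alpha))%:E)%E).
  rewrite -EFinM lee_fin -mulrA -expRD.
  have -> : - alpha * t + t * alpha = 0 by ring.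
  by rewrite expR0 mulr1.
by rewrite lee_wpmul2r// lee_fin expR_ge0.
Qed.

Lemma slow_dual_limsup k : 0 < k ->
  (forall t, 1 <= t -> ((k * expR (- alpha * t))%:E <= dual_norm H t v ^+ 2)%E) ->
  (- g%:E < limf_esup (fun t : R => (t^-1)%:E * lne (dual_norm H t v ^+ 2)) +oo%R)%E.
Proof.
move=> k0 low; rewrite ltNge; apply/negP => le_g.
pose m := (alpha + g) / 2.
have : (limf_esup (fun t : R => (t^-1)%:E * lne (dual_norm H t v ^+ 2)) +oo%R
    < (- m)%:E)%E.
  by apply: le_lt_trans le_g _; rewrite -EFinN lte_fin ltrN2 (midf_lt ag).2.
move=> /ereal_inf_lt[_ [A [M [_ MA]] <-]] supA.
have ma : 0 < m - alpha by rewrite subr_gt0 (midf_lt ag).1.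
(* A time lying in [A] and so large that |ln k| <= (m - alpha) t, whence the quotient at [t] is at
   least -m. *)
pose t := `|M| + 1 + `|ln k| / (m - alpha).
have p0 : 0 <= `|ln k| / (m - alpha) by rewrite divr_ge0// ltW.
have t1 : 1 <= t by rewrite /t; have := normr_ge0 M; lra.
have t0 : 0 < t by exact: lt_le_trans t1.
have At : A t by apply: MA; rewrite /t; have := ler_norm M; lra.
have : ((t^-1)%:E * lne (dual_norm H t v ^+ 2) < (- m)%:E)%E.
  by apply: le_lt_trans supA; apply: ereal_sup_ubound; exists t.
apply/negP; rewrite -leNgt.
apply: (@le_trans _ _ ((t^-1)%:E * (ln k - alpha * t)%:E)%E); last first.
  rewrite lee_wpmul2l ?lee_fin ?invr_ge0 ?(ltW t0)//.
  have -> : (ln k - alpha * t)%:E = lne (k * expR (- alpha * t))%:E.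
    by rewrite lne_EFin ?mulr_gt0 ?expR_gt0// lnM ?posrE ?expR_gt0// expRK mulNr.
  rewrite lee_lne ?low//.
  - by rewrite in_itv /= leey lee_fin mulr_ge0 ?expR_ge0// ltW.
  - by rewrite in_itv /= leey dual_norm_sqr_ge0.
rewrite -EFinM lee_fin mulrC ler_pdivlMr//.
have : `|ln k| <= (m - alpha) * t.
  rewrite /t !mulrDr [_ * (_ / _)]mulrC divfK ?gt_eqF// lerDr.
  by rewrite -mulrDr mulr_ge0 ?(ltW ma)// addr_ge0.
by have := ler_norm (- ln k); rewrite normrN; lra.
Qed.

End Equivalences.

Theorem theorem1p1 (R : realType) (n : nat) (hn : (1 <= n)%N)
    (V : vectType R[i]) (hV : \dim {:V} = n)
    (H : R -> {dot V for Num.conj})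
    (Hcurv : negative_curvature H)
    (Hgrowth : moderate_growth H)
    (Hext : extends_to_zero H)
    (j : nat) (hj : (j < n)%N) (alpha : R)
    (hlo : (jumping_number H j <= alpha%:E)%E)
    (hhi : (alpha%:E < jumping_number H j.+1)%E)
    (v : 'Hom(V, (R[i])^o)) :
  [<-> annihilator H (jumping_number H j) v;
       (\int[lebesgue_measure]_(t in `[0%R, +oo[)
          (dual_norm H t v ^+ 2 * (expR (t * alpha))%:E) < +oo)%E;
       (limf_esup (fun t : R => (t^-1)%:E * lne (dual_norm H t v ^+ 2)) +oo%R
          <= - jumping_number H j.+1)%E].
Proof.
have hF := negative_curvature_log_convex Hcurv Hgrowth.
have hG := moderate_growth_le Hgrowth.
have jV : (j < \dim {:V})%N by rewrite hV.
have [g [gE ag gap]] := filtration_gap hF hG jV hlo hhi.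
have decay : annihilator H (jumping_number H j) v ->
    forall b, b < g -> exists2 T0, 0 < T0 & forall t, T0 <= t ->
      (dual_norm H t v ^+ 2 <= (expR (- b * t))%:E)%E.
  move=> vF b bg.
  have v_slow u c : c < g -> growth_le (sqform H) u c -> v u = 0.
    by move=> cg uc; apply: vF; exact: gap cg uc.
  have [T0 T00 hT] := dual_decay hF v_slow bg.
  exists T0 => // t Tt; apply: dual_norm_sqr_le => [|u]; first exact: expR_ge0.
  by rewrite metric_norm_sqr ?hT//; exact: lt_le_trans Tt.
have slow : ~ annihilator H (jumping_number H j) v ->
    exists2 k, 0 < k & forall t, 1 <= t ->
      ((k * expR (- alpha * t))%:E <= dual_norm H t v ^+ 2)%E.
  move=> /existsNP[u /not_implyP[uF /eqP vu]].
  exact: slow_dual_lower_bound vu (filtration_growth hF hG jV hlo uF).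
(* The cycle is (a) to (b) to (c) to (a). The second implication first recovers (a), since without
   it the integral diverges. *)
rewrite gE; tfae.
- by move=> /decay; exact: fast_decay_integral.
- move=> fin; apply: fast_decay_limsup; apply: decay; apply: contrapT => /slow[k k0 low].
  by move: fin; rewrite (slow_dual_integral k0 low) ltxx.
- move=> le_g; apply: contrapT => /slow[k k0 low].
  by have := slow_dual_limsup ag k0 low; rewrite ltNge le_g.
Qed.
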